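(* Let $(\Omega,\sigma)$ be a continuous global real flow on a compact metric space, $\omega\cdot t:=\sigma(t,\omega)$. Let $H=\begin{bmatrix}H_1 & H_3 \\ H_2 & -H_1^T\end{bmatrix}\colon\Omega\to\mathfrak{sp}(n,\mathbb{R})$ and $\Delta\colon\Omega\to\mathbb{S}_n(\mathbb{R})$ be continuous, and suppose that $\Delta$ takes positive definite values. For $\lambda\in\mathbb{C}$ let $(\widetilde F^\lambda)$ denote the family $$\mathbf{z}'=\begin{bmatrix}H_1(\omega\cdot t) & H_3(\omega\cdot t) \\ H_2(\omega\cdot t)+\lambda\Delta(\omega\cdot t) & -H_1^T(\omega\cdot t)\end{bmatrix}\mathbf{z},\qquad\omega\in\Omega.$$ Then there are two dynamical possibilities: O1$^*$. There exists $\lambda_0\in\mathbb{C}$ such that $(\widetilde F^{\lambda_0})$ has exponential dichotomy. In this case the families $(\widetilde F^\lambda)$ have exponential dichotomy for (at least) all $\lambda\in\mathbb{C}-\mathbb{R}$. O2$^*$. The family $(\widetilde F^\lambda)$ does not have exponential dichotomy for any $\lambda\in\mathbb{C}$. Equivalently, there exist a point $\omega\in\Omega$ and $\lambda_0\in\mathbb{C}$ such that the system of $(\widetilde F^{\lambda_0})$ corresponding to $\omega$ admits a nonzero bounded solution (on $\mathbb{R}$) of the form $\mathbf{z}(t,\omega)=\begin{bmatrix}\mathbf{0} \\ \mathbf{z}_2(t,\omega)\end{bmatrix}$, in which case this function solves the system of $(\widetilde F^\lambda)$ corresponding to $\omega$ for all $\lambda\in\mathbb{C}$.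
   Context: Notation: $\mathbb{S}_n(\mathbb{R})$ is the set of real symmetric $n\times n$ matrices. $J=\begin{bmatrix}0_n & -I_n \\ I_n & 0_n\end{bmatrix}$ and $\mathfrak{sp}(n,\mathbb{K})=\{H\in\mathbb{M}_{2n\times2n}(\mathbb{K}) : H^TJ+JH=0\}$ for $\mathbb{K}=\mathbb{R}$ or $\mathbb{C}$ (so that $H_2,H_3$ are symmetric). For a family $\mathbf{z}'=H(\omega\cdot t)\mathbf{z}$, $\omega\in\Omega$, with continuous $H\colon\Omega\to\mathfrak{sp}(n,\mathbb{K})$, let $U(t,\omega)$ be the fundamental matrix with $U(0,\omega)=I_{2n}$. The family has exponential dichotomy if there exist $\eta\ge1$, $\beta>0$ and a splitting $\Omega\times\mathbb{K}^{2n}=L^+\oplus L^-$ into the Whitney sum of two closed subbundles, invariant under $(t,\omega,\mathbf{z})\mapsto(\omega\cdot t,U(t,\omega)\mathbf{z})$, with $\|U(t,\omega)\mathbf{z}\|\le\eta e^{-\beta t}\|\mathbf{z}\|$ for $t\ge0$, $(\omega,\mathbf{z})\in L^+$, and $\|U(t,\omega)\mathbf{z}\|\le\eta e^{\beta t}\|\mathbf{z}\|$ for $t\le0$, $(\omega,\mathbf{z})\in L^-$. *)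

(* Defs.v *)
From HB Require Import structures.
From mathcomp Require Import all_boot all_order all_algebra.
From mathcomp Require Import complex.
From mathcomp Require Import all_classical all_reals all_analysis.

Set Implicit Arguments.
Unset Strict Implicit.
Unset Printing Implicit Defensive.

Import Order.TTheory GRing.Theory Num.Theory.
Import numFieldNormedType.Exports.

Local Open Scope classical_set_scope.
Local Open Scope ring_scope.

(* MathComp-Analysis attaches the topology given by the modulus to an element
   of numClosedFieldType, not to the type constructor [complex]; naming the
   structure lets the instances be inferred. *)
Definition Cplx (R : realType) : numClosedFieldType := R[i].

Section Defs.
Variable R : realType.
Local Notation C := (Cplx R).

Definition toC (x : R) : C := real_complex R x.
Definition re (x : C) : R := complex.Re x.
Definition im (x : C) : R := complex.Im x.

Definition vnorm m (z : 'cV[C]_m) : R :=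
  Num.sqrt (\sum_i (re (z i 0) ^+ 2 + im (z i 0) ^+ 2)).

(* F is differentiable at t with derivative F' (real variable, complex matrix
   values); complex matrices carry no real normed-module structure in the
   library, so the derivative is taken on real and imaginary parts of entries. *)
Definition is_derive_mx m p (F : R -> 'M[C]_(m, p)) (t : R) (F' : 'M[C]_(m, p))
    : Prop :=
  forall i j, is_derive t 1 (fun s => re (F s i j)) (re (F' i j)) /\
              is_derive t 1 (fun s => im (F s i j)) (im (F' i j)).

Definition Jmx (K : nzRingType) n : 'M[K]_(n + n) :=
  block_mx 0 (- 1%:M) 1%:M 0.

Definition sp (K : nzRingType) n (H : 'M[K]_(n + n)) : Prop :=
  H^T *m Jmx K n + Jmx K n *m H = 0.

Definition symmetric_mx n (D : 'M[R]_n) : Prop := D^T = D.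

Definition posdef_mx n (D : 'M[R]_n) : Prop :=
  forall v : 'cV[R]_n, v != 0 -> 0 < (v^T *m D *m v) 0 0.

Definition continuous_flow (Omega : topologicalType) (sigma : R -> Omega -> Omega)
    : Prop :=
  [/\ continuous (fun p : R * Omega => sigma p.1 p.2),
      forall w, sigma 0 w = w &
      forall s t w, sigma (s + t) w = sigma s (sigma t w)].

Section Family.
Variables (Omega : topologicalType) (sigma : R -> Omega -> Omega).
Variables (m : nat) (A : Omega -> 'M[C]_m).

Definition is_solution (w : Omega) (z : R -> 'cV[C]_m) : Prop :=
  forall t, is_derive_mx z t (A (sigma t w) *m z t).

Definition fundamental_matrix (U : R -> Omega -> 'M[C]_m) : Prop :=
  forall w, U 0 w = 1%:M /\
    forall t, is_derive_mx (U^~ w) t (A (sigma t w) *m U t w).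

(* A subbundle of Omega x C^m, given by its fibers: the total space is closed
   and the dimension of the fibers is locally constant (together these amount
   to local triviality). *)
Definition closed_subbundle (L : Omega -> {vspace 'cV[C]_m}) : Prop :=
  closed [set p : Omega * 'cV[C]_m | p.2 \in L p.1] /\
  forall w, \forall w' \near w, \dim (L w') = \dim (L w).

Definition whitney_sum (L1 L2 : Omega -> {vspace 'cV[C]_m}) : Prop :=
  forall w, (L1 w + L2 w)%VS = fullv /\ (L1 w :&: L2 w)%VS = 0%VS.

Definition invariant_subbundle (U : R -> Omega -> 'M[C]_m)
    (L : Omega -> {vspace 'cV[C]_m}) : Prop :=
  forall t w z, z \in L w -> U t w *m z \in L (sigma t w).

Definition exponential_dichotomy : Prop :=
  exists2 U : R -> Omega -> 'M[C]_m, fundamental_matrix U &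
  exists (eta beta : R) (Lp Lm : Omega -> {vspace 'cV[C]_m}),
    [/\ 1 <= eta /\ 0 < beta,
        closed_subbundle Lp /\ closed_subbundle Lm,
        whitney_sum Lp Lm,
        invariant_subbundle U Lp /\ invariant_subbundle U Lm &
        (forall (t : R) w z, 0 <= t -> z \in Lp w ->
           vnorm (U t w *m z) <= eta * expR (- beta * t) * vnorm z) /\
        (forall (t : R) w z, t <= 0 -> z \in Lm w ->
           vnorm (U t w *m z) <= eta * expR (beta * t) * vnorm z)].

End Family.

Definition bounded_on_R m (z : R -> 'cV[C]_m) : Prop :=
  exists M : R, forall t, vnorm (z t) <= M.

Definition family_coef (Omega : Type) n (H1 H2 H3 Delta : Omega -> 'M[R]_n)
    (lambda : C) (w : Omega) : 'M[C]_(n + n) :=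
  block_mx (map_mx toC (H1 w)) (map_mx toC (H3 w))
           (map_mx toC (H2 w) + lambda *: map_mx toC (Delta w))
           (- (map_mx toC (H1 w))^T).

Definition vertical_bounded_solution (Omega : topologicalType)
    (sigma : R -> Omega -> Omega) n (A : Omega -> 'M[C]_(n + n)) (w : Omega)
    (z : R -> 'cV[C]_(n + n)) : Prop :=
  [/\ is_solution sigma A w z, (exists t, z t != 0), bounded_on_R z &
      (exists z2 : R -> 'cV[C]_n, forall t, z t = col_mx 0 (z2 t))].

End Defs.

(* Main.v *)
Require Import Defs.
From HB Require Import structures.
From mathcomp Require Import all_boot all_order all_algebra.
From mathcomp Require Import complex.
From mathcomp Require Import all_classical all_reals all_analysis.
From mathcomp Require Import ring lra zify.

(* Fix a nonreal parameter.  Along solutions the derivative of the Krein form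
   i z^* J z is a multiple of z1^* Delta z1 of constant sign, so the form is a
   monotone quadratic function of time.

   If no vertical bounded solution exists, then no nonzero bounded solution
   exists: on the alpha- and omega-limit sets of a bounded solution the form is
   constant, hence these consist of vertical bounded orbits, which vanish; so the
   form tends to 0 at both ends, is identically 0, and the solution is vertical.

   By compactness there is T such that every solution is at some time of [-T, T]
   at least twice as large as at time 0 (four times, for squared norms).  Hence
   half-orbits that are bounded decay exponentially, uniformly, and the initial
   data with bounded forward (backward) orbit form fibers with closed total space
   that intersect in 0.  It remains to see that both have dimension at least n.
   Pull back, from time T' to time 0, an n-dimensional subspace on which the form
   is definite: where such a solution is largest on [0, T'], the expansion forces
   it to be near one of the ends, and monotonicity of the form bounds its size at
   T' by its size at 0.  The bound being uniform in T', limits of these subspaces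
   consist of bounded half-orbits.

   Conversely exponential dichotomy excludes nonzero bounded solutions, and a
   vertical solution does not see the parameter. *)

Set Implicit Arguments.
Unset Strict Implicit.
Unset Printing Implicit Defensive.

Import Order.TTheory GRing.Theory Num.Theory.
Import numFieldNormedType.Exports.

Local Open Scope classical_set_scope.
Local Open Scope ring_scope.

(** * Calculus on the line *)

Section RealCalculus.
Variable R : realType.
Implicit Types (f g : R -> R) (a b c e s t T : R).

Lemma is_derive_add f g t a b : is_derive t 1 f a -> is_derive t 1 g b ->
  is_derive t 1 (fun s => f s + g s) (a + b).
Proof. exact: is_deriveD. Qed.

Lemma is_derive_sub f g t a b : is_derive t 1 f a -> is_derive t 1 g b ->
  is_derive t 1 (fun s => f s - g s) (a - b).
Proof. exact: is_deriveB. Qed.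

Lemma is_derive_opp f t a : is_derive t 1 f a ->
  is_derive t 1 (fun s => - f s) (- a).
Proof. exact: is_deriveN. Qed.

Lemma is_derive_mul f g t a b : is_derive t 1 f a -> is_derive t 1 g b ->
  is_derive t 1 (fun s => f s * g s) (a * g t + f t * b).
Proof.
move=> df dg; apply: is_derive_eq (@is_deriveM _ _ _ _ _ _ _ _ df dg) _.
by rewrite /GRing.scale /= addrC mulrC.
Qed.

Lemma is_derive_const c t : is_derive t 1 (fun=> c : R) 0.
Proof. exact: is_derive_cst. Qed.

Lemma is_derive_cmul c f t a : is_derive t 1 f a ->
  is_derive t 1 (fun s => c * f s) (c * a).
Proof.
move=> df; apply: is_derive_eq (is_derive_mul (is_derive_const c t) df) _.
by rewrite mul0r add0r.
Qed.

Lemma is_derive_bigsum (I : finType) (P : pred I) (f : I -> R -> R) (f' : I -> R) t :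
  (forall i, is_derive t 1 (f i) (f' i)) ->
  is_derive t 1 (fun s => \sum_(i | P i) f i s) (\sum_(i | P i) f' i).
Proof.
move=> df; rewrite /index_enum; elim: (Finite.enum I) => [|i r IH].
  under eq_fun do rewrite big_nil.
  by rewrite big_nil; exact: is_derive_const.
under eq_fun do rewrite big_cons.
by rewrite big_cons; case: (P i) => //; exact: is_derive_add.
Qed.

Lemma is_derive_compM f c t a : is_derive (c * t) 1 f a ->
  is_derive t 1 (fun s => f (c * s)) (a * c).
Proof.
move=> df; apply: (@is_derive1_comp _ f (fun s => c * s)) => //.
apply: is_derive_eq (is_derive_cmul c (is_derive_id t 1)) _; exact: mulr1.
Qed.

Lemma is_derive_expM c t :
  is_derive t 1 (fun s => expR (c * s)) (c * expR (c * t)).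
Proof.
apply: is_derive_eq (@is_derive_compM expR c t _ (is_derive_expR _)) _.
exact: mulrC.
Qed.

Lemma is_derive_continuous f f' : (forall t, is_derive t 1 f (f' t)) ->
  continuous f.
Proof.
move=> df t; have dft := df t.
exact/differentiable_continuous/derivable1_diffP.
Qed.

Lemma is_derive_ge0_le f (f' : R -> R) a b : a <= b ->
  (forall t, is_derive t 1 f (f' t)) ->
  (forall t, a <= t <= b -> 0 <= f' t) -> f a <= f b.
Proof.
move=> ab df f'0.
have cf : {within `[a, b], continuous f}.
  exact/continuous_subspaceT/(is_derive_continuous df).
have [c cab fE] := @MVT_segment R f f' a b ab (fun t _ => df t) cf.
by rewrite -subr_ge0 fE mulr_ge0 ?subr_ge0// f'0.
Qed.

Lemma is_derive_le f g (f' g' : R -> R) a b : a <= b ->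
  (forall t, is_derive t 1 f (f' t)) -> (forall t, is_derive t 1 g (g' t)) ->
  (forall t, a <= t <= b -> f' t <= g' t) -> f b - f a <= g b - g a.
Proof.
move=> ab df dg le; suff : g a - f a <= g b - f b by lra.
apply: (@is_derive_ge0_le (fun t => g t - f t) (fun t => g' t - f' t)) => //.
by move=> t /le; rewrite subr_ge0.
Qed.

(** On [[0, T]] the function [(f t + e / c) * expR (- c * t)] is nonincreasing, since the
    differential inequality makes its derivative nonpositive. *)
Lemma gronwall_right f (f' : R -> R) c e T : 0 < c -> 0 <= T ->
  (forall t, is_derive t 1 f (f' t)) ->
  (forall t, 0 <= t <= T -> f' t <= c * f t + e) ->
  f T + e / c <= (f 0 + e / c) * expR (c * T).
Proof.
move=> c0 T0 df le.
pose g t := (f t + e / c) * expR (- c * t).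
suff : g T <= g 0.
  rewrite /g mulr0 expR0 mulr1 => h.
  have := ler_wpM2r (expR_ge0 (c * T)) h.
  by rewrite -mulrA -expRD mulNr addNr expR0 mulr1.
rewrite -lerN2.
apply: (@is_derive_ge0_le (fun t => - g t)
  (fun t => - (f' t * expR (- c * t) + (f t + e / c) * (- c * expR (- c * t)))))
  => //.
  move=> t; apply: is_derive_opp.
  apply: is_derive_mul; last exact: is_derive_expM.
  by rewrite -[f' t]addr0; exact: is_derive_add (is_derive_const _ _).
move=> t /le h; rewrite oppr_ge0.
rewrite mulrA -mulrDl pmulr_lle0 ?expR_gt0//.
have -> : (f t + e / c) * - c = - (c * f t + e) by field; rewrite gt_eqF.
lra.
Qed.

(** The bound on the absolute value of [f'] survives time reversal, so negative times reduce to
    [gronwall_right] for the reflected function. *)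
Lemma gronwall f (f' : R -> R) c e T t : 0 < c -> `|t| <= T ->
  (forall s, is_derive s 1 f (f' s)) ->
  (forall s, `|s| <= T -> `|f' s| <= c * f s + e) ->
  f t + e / c <= (f 0 + e / c) * expR (c * `|t|).
Proof.
move=> c0 tT df le.
have [t0|t0] := leP 0 t.
  rewrite ger0_norm//; apply: gronwall_right df _ => // s /andP[s0 st].
  apply: le_trans (ler_norm _) (le _ _); rewrite ger0_norm//.
  by apply: le_trans tT; rewrite (ger0_norm t0).
rewrite ltr0_norm//.
have := @gronwall_right (fun s => f (- 1 * s)) (fun s => f' (- 1 * s) * - 1) c e (- t).
rewrite mulN1r opprK mulr0; apply => //; first lra.
  by move=> s; exact: is_derive_compM.
move=> s /andP[s0 st]; rewrite mulrN1; apply: le_trans (ler_norm _) _.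
rewrite normrN; apply: le; rewrite mulN1r normrN ger0_norm//.
by apply: le_trans tT; rewrite (ltr0_norm t0).
Qed.

Lemma is_derive_MVT f (f' : R -> R) a b : a <= b ->
  (forall t, a <= t <= b -> is_derive t 1 f (f' t)) ->
  exists2 c, a <= c <= b & f b - f a = f' c * (b - a).
Proof.
move=> ab df.
have cf : {within `[a, b], continuous f}.
  apply: derivable_within_continuous => x; rewrite in_itv/= => xab.
  by have [] := df x xab.
have df' x : x \in `]a, b[%R -> is_derive x 1 f (f' x).
  by rewrite in_itv/= => /andP[ax xb]; apply: df; rewrite !ltW.
by have [c cab fE] := MVT_segment ab df' cf; exists c.
Qed.

(** The integral from a base point [a] is differentiated only at points beyond [a]. The base point
    therefore varies with [t], staying to the left of both [t] and 0; normalization at 0 makes the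
    result independent of it. *)
Lemma continuous_antiderivative f : continuous f ->
  exists F : R -> R, F 0 = 0 /\ forall t, is_derive t 1 F (f t).
Proof.
move=> cf.
have [G dG] : exists G : R -> R -> R,
    forall a x, a < x -> is_derive x 1 (G a) (f x).
  exists (fun a x => (\int[@lebesgue_measure R]_(s in [set` `[a, x]]) f s)%R).
  move=> a x ax.
  have xx : x < x + 1 by rewrite ltrDl.
  have fi : (@lebesgue_measure R).-integrable `[a, x + 1] (EFin \o f).
    apply: continuous_compact_integrable; first exact: segment_compact.
    exact: continuous_subspaceT.
  have [dG dGE] := continuous_FTC1_closed xx fi ax (cf x).
  move: dGE; rewrite derive1E => dGE.
  exact: (DeriveDef dG dGE).
(* The difference of two such integrals has zero derivative on the common domain, so both have the
   same increment from 0 to [t]. *)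
have G0 a b t : a < t -> b < t -> a < 0 -> b < 0 ->
    G a t - G a 0 = G b t - G b 0.
  move=> at_ bt a0 b0; pose k s := G a s - G b s.
  have dk s : a < s -> b < s -> is_derive s 1 k 0.
    move=> as_ bs; rewrite -(subrr (f s)).
    by apply: is_derive_sub; exact: dG.
  suff : k t = k 0 by rewrite /k; lra.
  have [t0|t0] := leP 0 t.
    have [s /andP[s0 st]|c _] := @is_derive_MVT k (fun=> 0) 0 t t0.
      by apply: dk; exact: lt_le_trans s0.
    by rewrite mul0r => /eqP; rewrite subr_eq0 => /eqP.
  have [s /andP[s0 st]|c _] := @is_derive_MVT k (fun=> 0) t 0 (ltW t0).
    by apply: dk; exact: lt_le_trans s0.
  by rewrite mul0r => /eqP; rewrite subr_eq0 => /eqP ->.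
pose A t := Num.min t 0 - 1.
have At t : A t < t by rewrite /A ltrBlDr gt_min ltrDl ltr01.
have A0 t : A t < 0 by rewrite /A ltrBlDr gt_min add0r ltr01 orbT.
exists (fun t => G (A t) t - G (A t) 0); split; first by rewrite subrr.
move=> t.
have dF : is_derive t 1 (fun s => G (A t) s - G (A t) 0) (f t).
  rewrite -[f t]subr0; apply: is_derive_sub; exact: dG.
(* Near [t] the moving base point may be frozen at [A t]. *)
apply: near_eq_is_derive dF.
near=> s; apply: G0 => //.
by near: s; exact: lt_nbhsr.
Unshelve. all: by end_near. Qed.

End RealCalculus.

(** * Continuity of sums and products of real functions *)

Section ContinuousReal.
Variables (R : realType) (T : topologicalType).
Implicit Types f g : T -> R.

Lemma continuous_add f g : continuous f -> continuous g ->
  continuous (fun x => f x + g x).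
Proof. by move=> cf cg x; apply: cvgD; [exact: cf|exact: cg]. Qed.

Lemma continuous_sub f g : continuous f -> continuous g ->
  continuous (fun x => f x - g x).
Proof. by move=> cf cg x; apply: cvgB; [exact: cf|exact: cg]. Qed.

Lemma continuous_mul f g : continuous f -> continuous g ->
  continuous (fun x => f x * g x).
Proof. by move=> cf cg x; apply: cvgM; [exact: cf|exact: cg]. Qed.

Lemma continuous_bigsum (J : finType) (f : J -> T -> R) :
  (forall j, continuous (f j)) -> continuous (fun s => \sum_j f j s).
Proof. by move=> cf; apply: continuous_big => // ?; exact: add_continuous. Qed.

End ContinuousReal.

Lemma continuous_pair (T U V : topologicalType) (f : T -> U) (g : T -> V) :
  continuous f -> continuous g -> continuous (fun x => (f x, g x)).
Proof. by move=> cf cg x; exact: (cvg_pair (cf x) (cg x)). Qed.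

(** * Geometric error bounds *)

Section GeometricTail.
Variable R : realType.
Implicit Types (c e x : R).

Lemma geometric_small c e : 0 < e -> exists k : nat, c * (2^-1) ^+ k < e.
Proof.
move=> e0; have [k ck] : exists k : nat, c / e < k%:R.
  exists (Num.bound `|c / e|).
  exact: le_lt_trans (ler_norm _) (archi_boundP (normr_ge0 _)).
exists k; rewrite exprVn ltr_pdivrMr ?exprn_gt0// -ltr_pdivrMl// mulrC.
by apply: lt_trans ck _; rewrite -natrX ltr_nat ltn_expl.
Qed.

Lemma le_geometric x y c : (forall k : nat, x <= y + c * (2^-1) ^+ k) -> x <= y.
Proof.
move=> le; rewrite leNgt; apply/negP => xy.
have [k] := @geometric_small c (x - y) ltac:(lra).
by have := le k; lra.
Qed.

(** The intervals of radius [2 * c * (2^-1) ^+ k] around [u k] are nested, and the supremum of their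
    left ends lies in all of them. *)
Lemma geometric_limit (u : nat -> R) c : 0 <= c ->
  (forall k : nat, `|u k.+1 - u k| <= c * (2^-1) ^+ k) ->
  exists l, forall k, `|l - u k| <= 2 * c * (2^-1) ^+ k.
Proof.
move=> c0 le.
pose p k := u k - 2 * c * (2^-1) ^+ k; pose q k := u k + 2 * c * (2^-1) ^+ k.
have pS k : p k <= p k.+1.
  by have := le k; rewrite ler_norml /p exprS => /andP[]; lra.
have qS k : q k.+1 <= q k.
  by have := le k; rewrite ler_norml /q exprS => /andP[]; lra.
have pH := homo_leq lexx le_trans pS.
have qH := homo_leq lexx (fun x y z xy yz => le_trans yz xy) qS.
have pq k : p k <= q k.
  have : 0 <= 2 * c * (2^-1) ^+ k by rewrite !mulr_ge0// exprn_ge0.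
  by rewrite /p /q; lra.
have pq' j k : p j <= q k.
  apply: le_trans (pH _ _ (leq_maxl j k)) _.
  exact: le_trans (pq _) (qH _ _ (leq_maxr j k)).
exists (sup (range p)) => k; rewrite ler_norml.
have sp : has_sup (range p).
  by split; [exists (p 0), 0%N|exists (q 0) => _ [j _ <-]].
have h1 : p k <= sup (range p) by apply: sup_upper_bound => //; exists k.
have h2 : sup (range p) <= q k by apply: ge_sup => [|_ [j _ <-]//]; exists (p 0), 0%N.
by move: h1 h2; rewrite /p /q; lra.
Qed.

End GeometricTail.

(** * Linear differential equations *)

Section LinearODE.
Variables (R : realType) (I : finType).
Implicit Types (a : R -> I -> I -> R) (x y r : R -> I -> R).

Definition linear_solution a x :=
  forall (t : R) (i : I), is_derive t 1 (x ^~ i) (\sum_j a t i j * x t j).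

Definition sqnorm (v : I -> R) : R := \sum_i v i ^+ 2.

(** An exponential rate for [sqnorm] when the coefficients are bounded by [M]; the summand 1 absorbs
    a forcing term and keeps the rate positive. *)
Definition growth_rate (M : R) : R := 2 * M * #|I|%:R + 1.

Lemma growth_rate_gt0 M : 0 <= M -> 0 < growth_rate M.
Proof.
move=> M0; rewrite /growth_rate ltr_wpDl//.
by rewrite mulr_ge0 ?ler0n// mulr_ge0.
Qed.

Lemma sqnorm_ge0 v : 0 <= sqnorm v.
Proof. by apply: sumr_ge0 => i _; exact: sqr_ge0. Qed.

Lemma sqnorm_eq0 v : sqnorm v = 0 -> forall i, v i = 0.
Proof.
move=> /eqP; rewrite psumr_eq0 => [/allP v0 i|i _]; last exact: sqr_ge0.
by apply/eqP; rewrite -sqrf_eq0; apply: (v0 i); rewrite mem_index_enum.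
Qed.

(** Each product is at most [M / 2] times a sum of two squares; summing over all pairs of indices
    counts every square [#|I|] times in each position. *)
Lemma bilinear_bound (A : I -> I -> R) M v : (forall i j, `|A i j| <= M) ->
  `|\sum_i v i * \sum_j A i j * v j| <= M * #|I|%:R * sqnorm v.
Proof.
move=> AM.
have le i j : `|v i * (A i j * v j)| <= M / 2 * v i ^+ 2 + M / 2 * v j ^+ 2.
  rewrite !normrM mulrCA.
  have := AM i j; have := normr_ge0 (A i j).
  rewrite -[v i ^+ 2]real_normK ?num_real// -[v j ^+ 2]real_normK ?num_real//.
  move: `|A i j| `|v i| `|v j| (normr_ge0 (v i)) (normr_ge0 (v j)) => b p q p0 q0 b0 bM.
  have : b * (p * q) <= M * (p * q) by rewrite ler_wpM2r// mulr_ge0.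
  have : 0 <= M * (p - q) ^+ 2 by rewrite mulr_ge0 ?sqr_ge0// (le_trans b0).
  nra.
apply: le_trans (ler_norm_sum _ _ _) _.
apply: (@le_trans _ _ (\sum_i \sum_j (M / 2 * v i ^+ 2 + M / 2 * v j ^+ 2))).
  apply: ler_sum => i _; rewrite mulr_sumr.
  by apply: le_trans (ler_norm_sum _ _ _) (ler_sum _ _).
under eq_bigr do rewrite big_split/= sumr_const -mulr_sumr.
have -> : #|xpredT : pred I| = #|I| by apply: eq_card.
rewrite big_split/= sumr_const sumrMnl -mulr_sumr -/(sqnorm v).
rewrite -[X in X + _]mulr_natr -[X in _ + X]mulr_natr; lra.
Qed.

(** Gronwall's inequality for the squared norm, the forcing [r] being handled by
    [2 x r <= x^2 + r^2]. Zero forcing yields growth and uniqueness, small forcing yields continuous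
    dependence. *)
Lemma linear_energy a x r M e T t : 0 <= M -> `|t| <= T ->
  (forall s i j, `|a s i j| <= M) ->
  (forall (s : R) (i : I), is_derive s 1 (x ^~ i) (\sum_j a s i j * x s j + r s i)) ->
  (forall s, `|s| <= T -> sqnorm (r s) <= e) ->
  sqnorm (x t) + e / growth_rate M <=
    (sqnorm (x 0) + e / growth_rate M) * expR (growth_rate M * `|t|).
Proof.
move=> M0 tT aM dx re.
apply: (@gronwall _ (fun s => sqnorm (x s)) (fun s =>
   \sum_i ((\sum_j a s i j * x s j + r s i) * x s i
           + x s i * (\sum_j a s i j * x s j + r s i))) _ _ T) => //.
- exact: growth_rate_gt0.
- move=> s; apply: is_derive_bigsum => i; exact: is_derive_mul.
move=> s sT; pose p := \sum_i x s i * \sum_j a s i j * x s j.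
pose q := \sum_i x s i * r s i.
have -> : \sum_i ((\sum_j a s i j * x s j + r s i) * x s i
           + x s i * (\sum_j a s i j * x s j + r s i)) = 2 * p + 2 * q.
  by rewrite /p /q !mulr_sumr -big_split/=; apply: eq_bigr => i _; ring.
have pM : `|p| <= M * #|I|%:R * sqnorm (x s) by exact: bilinear_bound.
have qM : `|2 * q| <= sqnorm (x s) + sqnorm (r s).
  rewrite /q mulr_sumr /sqnorm -big_split/=; apply: le_trans (ler_norm_sum _ _ _) _.
  apply: ler_sum => i _; rewrite ler_norml; apply/andP; split.
    have := sqr_ge0 (x s i + r s i); nra.
  have := sqr_ge0 (x s i - r s i); nra.
have h : `|2 * p| <= 2 * M * #|I|%:R * sqnorm (x s).
  by rewrite normrM ger0_norm//; lra.
apply: le_trans (ler_normD _ _) _.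
have := re s sT; rewrite /growth_rate; lra.
Qed.

Lemma linear_growth a x M t : 0 <= M -> (forall s i j, `|a s i j| <= M) ->
  linear_solution a x ->
  sqnorm (x t) <= sqnorm (x 0) * expR (growth_rate M * `|t|).
Proof.
move=> M0 aM sx.
have := @linear_energy a x (fun _ _ => 0) M 0 `|t| t M0 (lexx _) aM.
rewrite mul0r !addr0; apply.
- by move=> s i; rewrite addr0; exact: sx.
- by move=> s _; rewrite /sqnorm big1// => i _; rewrite expr0n.
Qed.

Lemma linear_uniqueness a x y M : 0 <= M -> (forall s i j, `|a s i j| <= M) ->
  linear_solution a x -> linear_solution a y -> x 0 =1 y 0 ->
  forall t, x t =1 y t.
Proof.
move=> M0 aM sx sy xy0 t.
pose d s i := x s i - y s i.
have sd : linear_solution a d.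
  move=> s i; apply: is_derive_eq (is_derive_sub (sx s i) (sy s i)) _.
  by rewrite -sumrB; apply: eq_bigr => j _; rewrite -mulrBr.
have := linear_growth t M0 aM sd.
have -> : sqnorm (d 0) = 0.
  by rewrite /sqnorm big1// => i _; rewrite /d xy0 subrr expr0n.
rewrite mul0r => dt i; apply/eqP; rewrite -subr_eq0; apply/eqP.
by apply: (@sqnorm_eq0 (d t)); apply/eqP; rewrite eq_le dt sqnorm_ge0.
Qed.

(** Integrating the bound on [F'] gains a factor [1 / L], the source of contraction in Picard
    iteration. Nonnegative times are compared with [c * expR (L * s) - c]; negative times follow by
    reflection. *)
Lemma exp_primitive_bound (F F' : R -> R) (c L t : R) : 0 < L -> F 0 = 0 ->
  (forall s : R, is_derive s 1 F (F' s)) ->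
  (forall s, `|F' s| <= c * L * expR (L * `|s|)) ->
  `|F t| <= c * expR (L * `|t|).
Proof.
move=> L0.
have c0 (G : R -> R) : (forall s, `|G s| <= c * L * expR (L * `|s|)) -> 0 <= c.
  by move=> /(_ 0) /(le_trans (normr_ge0 _)); rewrite !pmulr_lge0 ?expR_gt0.
have H (G G' : R -> R) s : 0 <= s -> G 0 = 0 -> (forall s : R, is_derive s 1 G (G' s)) ->
    (forall s, `|G' s| <= c * L * expR (L * `|s|)) -> G s <= c * expR (L * s).
  move=> s0 G0 dG le.
  have := @is_derive_le _ G (fun s => c * expR (L * s)) G'
    (fun s => c * (L * expR (L * s))) 0 s s0 dG.
  rewrite G0 mulr0 expR0 mulr1 subr0 => h.
  apply: (@le_trans _ _ (c * expR (L * s) - c)); last by have := c0 _ le; lra.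
  apply: h.
  - by move=> u; apply: is_derive_cmul; exact: is_derive_expM.
  - move=> u /andP[u0 us]; apply: le_trans (ler_norm _) _.
    by have := le u; rewrite (ger0_norm u0) mulrA.
have H2 (G G' : R -> R) s : 0 <= s -> G 0 = 0 -> (forall s : R, is_derive s 1 G (G' s)) ->
    (forall s, `|G' s| <= c * L * expR (L * `|s|)) -> `|G s| <= c * expR (L * s).
  move=> s0 G0 dG le; rewrite ler_norml (H G G')// andbT lerNl.
  apply: (H (fun s => - G s) (fun s => - G' s)) => //.
  - by rewrite G0 oppr0.
  - by move=> u; rewrite normrN.
move=> F0 dF le; have [t0|t0] := leP 0 t.
  by rewrite (ger0_norm t0); exact: (H2 F F').
rewrite (ltr0_norm t0).
have := H2 (fun s => F (- 1 * s)) (fun s => F' (- 1 * s) * - 1) (- t).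
have -> : - 1 * - t = t by rewrite mulN1r opprK.
apply.
- by rewrite oppr_ge0 ltW.
- by rewrite mulr0.
- by move=> s; exact: is_derive_compM.
- by move=> s; rewrite mulrN1 normrN; have := le (- 1 * s); rewrite mulN1r normrN.
Qed.

(** Picard iteration on the whole line at once: iterates approach each other geometrically relative
    to an exponential weight, hence locally uniformly, and the limit is a continuous fixed point of
    the integral operator. *)
Lemma linear_existence a M (x0 : I -> R) : 0 <= M ->
  (forall s i j, `|a s i j| <= M) ->
  (forall i j, continuous (fun s => a s i j)) ->
  exists2 x, x 0 =1 x0 & linear_solution a x.
Proof.
move=> M0 aM ca.
have [A hA] : exists A : (R -> R) -> R -> R, forall f, continuous f ->
    A f 0 = 0 /\ forall t, is_derive t (1 : R) (A f) (f t).
  (* Integration becomes a total operator; a discontinuous function is sent to itself as a default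
     value. *)
  have /choice[A hA] : forall f : R -> R, exists F : R -> R, continuous f ->
      F 0 = 0 /\ forall t, is_derive t (1 : R) F (f t).
    move=> f; have [cf|ncf] := pselect (continuous f); last by exists f.
    by have [F hF] := continuous_antiderivative cf; exists F.
  by exists A.
pose P x t i := x0 i + A (fun s => \sum_j a s i j * x s j) t.
pose L := growth_rate M; have L0 : 0 < L by exact: growth_rate_gt0.
have csum x i : (forall j, continuous (x ^~ j)) ->
    continuous (fun s => \sum_j a s i j * x s j).
  move=> cx; apply: (@continuous_bigsum _ _ _ (fun j s => a s i j * x s j)) => j.
  by apply: continuous_mul; [exact: ca|exact: cx].
have dP x (t : R) i : (forall j, continuous (x ^~ j)) ->
    is_derive t 1 (P x ^~ i) (\sum_j a t i j * x t j).
  move=> cx; have [_ dA] := hA _ (csum x i cx).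
  by rewrite -[X in is_derive _ _ _ X]add0r; apply: is_derive_add.
have P0 x i : (forall j, continuous (x ^~ j)) -> P x 0 i = x0 i.
  by move=> cx; rewrite /P (hA _ (csum x i cx)).1 addr0.
have cP x i : (forall j, continuous (x ^~ j)) -> continuous (P x ^~ i).
  by move=> cx; apply: is_derive_continuous => t; exact: dP.
(* The weight [expR (L * `|t|)] makes the Picard operator a contraction of ratio 1/2. *)
have contr x y c : (forall j, continuous (x ^~ j)) -> (forall j, continuous (y ^~ j)) ->
    (forall s j, `|x s j - y s j| <= c * expR (L * `|s|)) ->
    forall t i, `|P x t i - P y t i| <= c / 2 * expR (L * `|t|).
  move=> cx cy le t i.
  have c0 : 0 <= c.
    by have := le_trans (normr_ge0 _) (le 0 i); rewrite pmulr_lge0 ?expR_gt0.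
  apply: (@exp_primitive_bound (fun s => P x s i - P y s i) (fun s =>
    \sum_j a s i j * x s j - \sum_j a s i j * y s j) (c / 2) L t L0).
  - by rewrite !P0// subrr.
  - by move=> s; apply: is_derive_sub; exact: dP.
  move=> s; rewrite -sumrB.
  apply: (@le_trans _ _ (\sum_(j : I) M * (c * expR (L * `|s|)))).
    apply: le_trans (ler_norm_sum _ _ _) (ler_sum _ _) => j _.
    by rewrite -mulrBr normrM ler_pM.
  rewrite sumr_const -[X in X <= _]mulr_natr.
  have -> : #|xpredT : pred I| = #|I| by apply: eq_card.
  have : 0 <= c * expR (L * `|s|) by rewrite mulr_ge0 ?expR_ge0.
  rewrite /L /growth_rate; move: (expR _) => E; lra.
pose S k := iter k P (fun _ => x0).
have cS k j : continuous (S k ^~ j).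
  by elim: k j => [j|k IH j] /=; [exact: cst_continuous|exact: cP].
(* [C] bounds the derivative of the first Picard increment, which starts the geometric estimate
   [dS]. *)
pose C := M * \sum_i `|x0 i|.
have C0 : 0 <= C by rewrite mulr_ge0// sumr_ge0.
have dS k t i : `|S k.+1 t i - S k t i| <= C / L * (2^-1) ^+ k * expR (L * `|t|).
  elim: k t i => [|k IH] t i.
    rewrite expr0 mulr1 /= .
    apply: (@exp_primitive_bound (fun s => P (fun=> x0) s i - x0 i)
       (fun s => \sum_j a s i j * x0 j)) => //.
    - by rewrite P0 ?subrr// => j; exact: cst_continuous.
    - move=> s; rewrite -[X in is_derive _ _ _ X]subr0; apply: is_derive_sub.
      by apply: dP => j; exact: cst_continuous.
    move=> s; rewrite divfK ?gt_eqF//; apply: (@le_trans _ _ C).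
      rewrite /C mulr_sumr; apply: le_trans (ler_norm_sum _ _ _) (ler_sum _ _) => j _.
      by rewrite normrM ler_wpM2r.
    rewrite ler_peMr//; apply: le_trans (expR_ge1Dx _).
    by rewrite lerDl mulr_ge0// ltW.
  rewrite exprSr mulrA; exact: (contr _ _ _ (cS _) (cS _) IH).
have /choice[x hx] : forall t, exists y : I -> R, forall i k,
    `|y i - S k t i| <= 2 * (C / L * expR (L * `|t|)) * (2^-1) ^+ k.
  move=> t; suff /choice[y hy] : forall i, exists y : R, forall k,
      `|y - S k t i| <= 2 * (C / L * expR (L * `|t|)) * (2^-1) ^+ k by exists y.
  move=> i; apply: geometric_limit.
    by rewrite mulr_ge0 ?expR_ge0// divr_ge0// ltW.
  by move=> k; rewrite mulrAC; exact: dS.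
have xS k t i : `|x t i - S k t i| <= 2 * (C / L) * (2^-1) ^+ k * expR (L * `|t|).
  by have := hx t i k; rewrite -!mulrA [expR _ * _]mulrC.
have cx j : continuous (x ^~ j).
  move=> t; apply/cvgrPdist_lt => e e0.
  (* On times of modulus at most [|t| + 1] a single iterate is within [e / 3] of [x]; continuity of
     that iterate supplies the remaining third. *)
  have [k ke] := @geometric_small R (2 * (C / L) * expR (L * (`|t| + 1)))
    (e / 3) ltac:(lra).
  have bnd s : `|s| <= `|t| + 1 -> `|x s j - S k s j| < e / 3.
    move=> st; apply: le_lt_trans (xS k s j) (le_lt_trans _ ke).
    rewrite mulrAC ler_wpM2r ?exprn_ge0// ler_wpM2l//.
      by rewrite mulr_ge0// divr_ge0// ltW.
    by rewrite ler_expR ler_wpM2l// ltW.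
  have := cS k j t => /cvgrPdist_lt/(_ (e / 3)) /(_ ltac:(lra)) cSk.
  near=> s.
  have h1 := bnd t ltac:(lra).
  have h2 : `|x s j - S k s j| < e / 3.
    apply: bnd; rewrite -lerBlDl; apply: le_trans (lerB_dist _ _) _.
    by near: s; apply: filterS (nbhsx_ballx t 1 ltr01) => s; rewrite /ball/=
      distrC => /ltW.
  have h3 : `|S k t j - S k s j| < e / 3 by near: s.
  rewrite -normrN opprB in h2.
  have -> : x t j - x s j = (x t j - S k t j) + (S k t j - S k s j) + (S k s j - x s j).
    by ring.
  apply: le_lt_trans (ler_normD _ _) _.
  apply: le_lt_trans (lerD (ler_normD _ _) (lexx _)) _.
  lra.
(* Both [x] and [P x] are geometrically close to the iterate [S k.+1]. *)
have Px t i : P x t i = x t i.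
  apply/eqP; rewrite -subr_eq0 -normr_le0.
  apply: (@le_geometric _ _ _ (2 * (C / L) * expR (L * `|t|))) => k.
  have h1 := xS k.+1 t i.
  have h2 := contr _ _ _ cx (cS k) (xS k) t i.
  rewrite distrC in h1.
  have -> : P x t i - x t i = (P x t i - S k.+1 t i) + (S k.+1 t i - x t i) by ring.
  apply: le_trans (ler_normD _ _) _; apply: le_trans (lerD h2 h1) _.
  by rewrite exprS; lra.
exists x => [i|t i]; first by rewrite -Px P0.
have -> : x ^~ i = P x ^~ i by apply/funext => s; rewrite Px.
exact: dP.
Unshelve. all: by end_near. Qed.

End LinearODE.

(** * Continuous dependence on a parameter *)

Section ContinuousDependence.
Variables (R : realType) (I : finType) (W : topologicalType).

(** The difference of the solutions for [w] and [w0] starts at 0 and solves the system of [w] with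
    forcing [r w], the change of coefficients applied to [x w0]. Near [w0] this forcing is uniformly
    small on a compact time interval, so [linear_energy] applies. *)
Lemma linear_continuous_dependence (a : W -> R -> I -> I -> R) (M : R)
    (x0 : I -> R) (x : W -> R -> I -> R) :
  0 <= M -> (forall w s i j, `|a w s i j| <= M) ->
  (forall i j, continuous (fun p : W * R => a p.1 p.2 i j)) ->
  (forall w, linear_solution (a w) (x w)) -> (forall w, x w 0 =1 x0) ->
  forall t i, continuous (fun w => x w t i).
Proof.
move=> M0 aM ca sx x_0 t i w0; apply/cvgrPdist_lt => e e0.
pose r w s k := \sum_j (a w s k j - a w0 s k j) * x w0 s j.
have cx j : continuous (fun s => x w0 s j).
  by apply: is_derive_continuous => s; exact: sx.
have c2 : continuous (fun p : W * R => p.2) by move=> ?; exact: cvg_snd.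
have cr : continuous (fun p : W * R => sqnorm (r p.1 p.2)).
  apply: continuous_bigsum => k.
  suff cr1 : continuous (fun p : W * R => r p.1 p.2 k).
    exact: (continuous_mul cr1 cr1).
  apply: (@continuous_bigsum _ _ _
    (fun j (p : W * R) => (a p.1 p.2 k j - a w0 p.2 k j) * x w0 p.2 j)) => j.
  apply: continuous_mul; last by move=> p; exact: (continuous_comp (c2 p) (cx j p.2)).
  apply: continuous_sub; first exact: ca.
  have c1 : continuous (fun _ : W * R => w0) by move=> q; exact: cvg_cst.
  by move=> p; exact: (continuous_comp (continuous_pair c1 c2 (x := p)) (ca k j (w0, p.2))).
pose c : R := growth_rate I M; have c0 : 0 < c by exact: growth_rate_gt0.
(* The bound [d] on the squared forcing is chosen so that the energy estimate at time [t] yields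
   [e ^+ 2 / 2]. *)
pose d := e ^+ 2 * c / 2 / expR (c * `|t|).
have d0 : 0 < d by rewrite !divr_gt0 ?expR_gt0 ?mulr_gt0 ?exprn_gt0.
(* Compactness of the time interval turns smallness near each [(w0, s)] into smallness for all [s]
   at once. *)
have small : \forall w \near w0, `[- `|t|, `|t|] `<=` (fun s => sqnorm (r w s) < d).
  have /compact_near_coveringP := @segment_compact R (- `|t|) `|t|.
  apply=> s _.
  have h0 : sqnorm (r w0 s) < d.
    rewrite /sqnorm big1// => k _; rewrite /r big1 ?expr0n// => j _.
    by rewrite subrr mul0r.
  have := cr (w0, s) _ (@lt_nbhsl _ _ _ h0).
  by case=> -[A B] /= [Aw Bs] AB; exists (B, A) => // -[s' w] /= [Bs' Aw'];
    exact: (AB (w, s')).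
near=> w.
have wd : `[- `|t|, `|t|] `<=` (fun s => sqnorm (r w s) < d) by near: w.
pose y s j := x w s j - x w0 s j.
have := @linear_energy R I (a w) y (r w) M d `|t| t M0 (lexx _) (aM w).
have y0 : sqnorm (y 0) = 0.
  by rewrite /sqnorm big1// => j _; rewrite /y !x_0 subrr expr0n.
rewrite y0 add0r => /(_ _ _)/wrap[].
- move=> s k; apply: is_derive_eq (is_derive_sub (sx w s k) (sx w0 s k)) _.
  rewrite /r -big_split/= -sumrB; apply: eq_bigr => j _; rewrite /y; ring.
- move=> s st; apply/ltW/wd; rewrite /= in_itv/=; move: st; rewrite ler_norml//.
move=> le.
have dE : d / growth_rate I M * expR (growth_rate I M * `|t|) = e ^+ 2 / 2.
  rewrite -/c /d; field; rewrite gt_eqF//= gt_eqF ?expR_gt0//.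
have yi : y t i ^+ 2 <= sqnorm (y t).
  by rewrite /sqnorm (bigD1 i)//= lerDl sumr_ge0// => k _; exact: sqr_ge0.
have dc0 : 0 < d / growth_rate I M by exact: divr_gt0.
have ye : y t i ^+ 2 < e ^+ 2.
  have : 0 < e ^+ 2 by rewrite exprn_gt0.
  by move: le; rewrite dE; lra.
rewrite distrC -/(y t i) -(@ltr_pXn2r _ 2)// ?nnegrE ?ltW//.
by rewrite real_normK ?num_real.
Unshelve. all: by end_near. Qed.

End ContinuousDependence.

(** * Complex vectors in real coordinates *)

Section ComplexCoordinates.
Variable R : realType.
Local Notation C := (Cplx R).

Lemma re_add (x y : C) : re (x + y) = re x + re y.
Proof. by case: x; case: y. Qed.

Lemma im_add (x y : C) : im (x + y) = im x + im y.
Proof. by case: x; case: y. Qed.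

Lemma re_mul (x y : C) : re (x * y) = re x * re y - im x * im y.
Proof. by case: x; case: y. Qed.

Lemma im_mul (x y : C) : im (x * y) = re x * im y + im x * re y.
Proof. by case: x => a b; case: y => c d. Qed.

Lemma re_sum (J : Type) (r : seq J) (P : pred J) (f : J -> C) :
  re (\sum_(j <- r | P j) f j) = \sum_(j <- r | P j) re (f j).
Proof. by apply: (big_morph _ re_add). Qed.

Lemma im_sum (J : Type) (r : seq J) (P : pred J) (f : J -> C) :
  im (\sum_(j <- r | P j) f j) = \sum_(j <- r | P j) im (f j).
Proof. by apply: (big_morph _ im_add). Qed.

Lemma cplx_eq (x y : C) : re x = re y -> im x = im y -> x = y.
Proof. by case: x => a b; case: y => c d /= -> ->. Qed.

Definition cplx (a b : R) : C := Complex a b.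

Lemma re_sub (x y : C) : re (x - y) = re x - re y.
Proof. by case: x; case: y. Qed.

Lemma im_sub (x y : C) : im (x - y) = im x - im y.
Proof. by case: x; case: y. Qed.

Lemma ltr_toC (a b : R) : (toC a < toC b :> C) = (a < b).
Proof. exact: ltcR. Qed.

Lemma cplx_normE (x : C) : `|x| = toC (Num.sqrt (re x ^+ 2 + im x ^+ 2)).
Proof. exact: normc_def. Qed.

Lemma re_continuous : continuous (@re R : C -> R).
Proof.
move=> x; have FF : Filter (nbhs x) := nbhs_filter x.
apply/cvgrPdist_lt => e e0.
have e0' : 0 < toC e :> C by rewrite -[0]/(toC 0) ltr_toC.
near=> y.
have : `|x - y| < toC e by near: y; apply: cvgr_dist_lt.
rewrite cplx_normE ltr_toC -re_sub; apply: le_lt_trans.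
by rewrite -sqrtr_sqr ler_wsqrtr// lerDl sqr_ge0.
Unshelve. all: by end_near. Qed.

Lemma im_continuous : continuous (@im R : C -> R).
Proof.
move=> x; have FF : Filter (nbhs x) := nbhs_filter x.
apply/cvgrPdist_lt => e e0.
have e0' : 0 < toC e :> C by rewrite -[0]/(toC 0) ltr_toC.
near=> y.
have : `|x - y| < toC e by near: y; apply: cvgr_dist_lt.
rewrite cplx_normE ltr_toC -im_sub; apply: le_lt_trans.
by rewrite -sqrtr_sqr ler_wsqrtr// lerDr sqr_ge0.
Unshelve. all: by end_near. Qed.

Lemma cplx_continuous (T : topologicalType) (f g : T -> R) :
  continuous f -> continuous g -> continuous (fun x => cplx (f x) (g x) : C).
Proof.
move=> cf cg x; apply/cvgrPdist_lt => /= e e0.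
have e0r : 0 < re e by move: e0; rewrite ltcE => /andP[].
have -> : e = toC (re e).
  by apply: cplx_eq => //=; move: e0; rewrite ltcE => /andP[/eqP].
near=> y.
have h1 : `|f x - f y| < re e / 2.
  by near: y; apply: cvgr_dist_lt; [exact: cf|exact: divr_gt0].
have h2 : `|g x - g y| < re e / 2.
  by near: y; apply: cvgr_dist_lt; [exact: cg|exact: divr_gt0].
rewrite cplx_normE ltr_toC re_sub im_sub /= -(@ltr_pXn2r _ 2)// ?nnegrE ?sqrtr_ge0 ?ltW//.
rewrite sqr_sqrtr ?addr_ge0 ?sqr_ge0//.
move: h1 h2; rewrite !ltr_norml => /andP[? ?] /andP[? ?]; nra.
Unshelve. all: by end_near. Qed.

Variable m : nat.
Implicit Types (z : 'cV[C]_m) (A : 'M[C]_m).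

(** With real and imaginary parts as coordinates, a complex system of size [m] becomes a real one
    indexed by ['I_m + 'I_m], with coefficients [real_coef]. *)
Definition coords z (k : 'I_m + 'I_m) : R :=
  match k with inl i => re (z i 0) | inr i => im (z i 0) end.

Definition of_coords (v : 'I_m + 'I_m -> R) : 'cV[C]_m :=
  \col_i cplx (v (inl i)) (v (inr i)).

Definition real_coef A (k l : 'I_m + 'I_m) : R :=
  match k, l with
  | inl i, inl j => re (A i j) | inl i, inr j => - im (A i j)
  | inr i, inl j => im (A i j) | inr i, inr j => re (A i j)
  end.

(** The square of [vnorm]: being polynomial in the coordinates, it is the quantity estimated
    throughout. *)
Definition nsq z : R := sqnorm (coords z).

Lemma of_coordsK v : coords (of_coords v) =1 v.
Proof. by case=> i; rewrite /= mxE. Qed.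

Lemma coordsK z : of_coords (coords z) = z.
Proof. by apply/colP => i; rewrite mxE; apply: cplx_eq. Qed.

Lemma coords_inj z z' : coords z =1 coords z' -> z = z'.
Proof.
by move=> /funext zz; rewrite -(coordsK z) zz coordsK.
Qed.

Lemma sum_coords (f : 'I_m + 'I_m -> R) :
  \sum_k f k = \sum_i f (inl i) + \sum_i f (inr i).
Proof. by rewrite big_sumType. Qed.

Lemma coords_mul A z k : coords (A *m z) k = \sum_l real_coef A k l * coords z l.
Proof.
rewrite sum_coords; case: k => i; rewrite /= mxE.
  rewrite re_sum -big_split/=; apply: eq_bigr => j _; rewrite re_mul; ring.
rewrite im_sum -big_split/=; apply: eq_bigr => j _; rewrite im_mul; ring.
Qed.

Lemma vnormE z : vnorm z = Num.sqrt (nsq z).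
Proof. by rewrite /vnorm /nsq /sqnorm sum_coords -big_split. Qed.

Lemma nsq_ge0 z : 0 <= nsq z.
Proof. exact: sqnorm_ge0. Qed.

Lemma nsq0_eq0 z : nsq z = 0 -> z = 0.
Proof.
move=> /sqnorm_eq0 z0; apply: coords_inj => k; rewrite z0.
by case: k => i; rewrite /= mxE.
Qed.

Lemma nsq0 : nsq 0 = 0.
Proof.
by rewrite /nsq /sqnorm big1// => -[] i _; rewrite /= mxE expr0n.
Qed.

Lemma nsq_scale (a : C) z : nsq (a *: z) = (re a ^+ 2 + im a ^+ 2) * nsq z.
Proof.
rewrite /nsq /sqnorm !sum_coords mulrDr !mulr_sumr -!big_split/=.
by apply: eq_bigr => i _; rewrite mxE re_mul im_mul; ring.
Qed.

Lemma nsq_add z z' : nsq (z + z') <= 2 * nsq z + 2 * nsq z'.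
Proof.
rewrite /nsq /sqnorm !mulr_sumr -big_split/=; apply: ler_sum => -[] i _ /=.
  rewrite mxE re_add; have := sqr_ge0 (re (z i 0) - re (z' i 0)); nra.
rewrite mxE im_add; have := sqr_ge0 (im (z i 0) - im (z' i 0)); nra.
Qed.

(** The factor is the inverse of the norm of [z]; quantifying over [B] lets the same rescaling apply
    to images under the propagator. *)
Lemma nsq_normalize z : z != 0 -> exists2 c : R, 0 < c &
  forall B : 'M[C]_m, nsq (B *m (toC c *: z)) = nsq (B *m z) / nsq z.
Proof.
move=> z0; have n0 : 0 < nsq z.
  by rewrite lt0r nsq_ge0 andbT; apply: contra_neq z0; exact: nsq0_eq0.
exists (Num.sqrt (nsq z))^-1 => [|B]; first by rewrite invr_gt0 sqrtr_gt0.
by rewrite -scalemxAr nsq_scale /= expr0n addr0 exprVn sqr_sqrtr ?nsq_ge0// mulrC.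
Qed.

Lemma coords_continuous k : continuous (fun z => coords z k).
Proof.
case: k => i z.
  exact: (continuous_comp (@coord_continuous C _ _ i 0 z) (@re_continuous (z i 0))).
exact: (continuous_comp (@coord_continuous C _ _ i 0 z) (@im_continuous (z i 0))).
Qed.

Lemma nsq_continuous : continuous nsq.
Proof.
apply: (@continuous_bigsum _ _ _ (fun k z => coords z k ^+ 2)) => k.
exact: (continuous_mul (@coords_continuous k) (@coords_continuous k)).
Qed.

Lemma nsq_mulmx_continuous A : continuous (fun z => nsq (A *m z)).
Proof.
apply: continuous_bigsum => k.
suff ck : continuous (fun z => coords (A *m z) k) by exact: (continuous_mul ck ck).
under eq_fun do rewrite coords_mul.
apply: continuous_bigsum => l; apply: continuous_mul; last exact: coords_continuous.
exact: cst_continuous.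
Qed.

(** The subspace is the zero set of the continuous function [nsq ((P - 1%:M) *m z)], where [P] is
    the matrix of a projection onto [W]. *)
Lemma closed_vspace (W : {vspace 'cV[C]_m}) : closed [set z | z \in W].
Proof.
pose P : 'M[C]_m := \matrix_(i, j) (projv W (delta_mx j 0)) i 0.
have PE z : projv W z = P *m z.
  have zE : z = \sum_j z j 0 *: delta_mx j (0 : 'I_1).
    rewrite {1}[z]matrix_sum_delta; apply: eq_bigr => j _.
    by rewrite big_ord1.
  rewrite {1}zE linear_sum; apply/colP => i; rewrite summxE mxE.
  by apply: eq_bigr => j _; rewrite linearZ !mxE mulrC.
have -> : [set z | z \in W] = (fun z => nsq ((P - 1%:M) *m z)) @^-1` [set x | x <= 0].
  apply/seteqP; split => z /=.
    by move=> zW; rewrite mulmxBl mul1mx -PE projv_id// subrr nsq0.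
  move=> z0; have /nsq0_eq0/eqP : nsq ((P - 1%:M) *m z) = 0.
    by apply/eqP; rewrite eq_le z0 nsq_ge0.
  by rewrite mulmxBl mul1mx -PE subr_eq0 => /eqP <-; exact: memv_proj.
exact: ((continuous_closedP _).1 (@nsq_mulmx_continuous _) _ (@closed_le _ 0)).
Qed.

(** The ball is the continuous image of a closed subset of a real cube, and a product of segments is
    compact. *)
Lemma compact_nsq_le (c : R) : compact [set z | nsq z <= c].
Proof.
pose f (v : 'rV[R]_(m + m)) : 'cV[C]_m :=
  \col_i cplx (v 0 (lshift m i)) (v 0 (rshift m i)).
have cv (k : 'I_(m + m)) : continuous (fun v : 'rV[R]_(m + m) => v 0 k : R).
  exact: coord_continuous.
have cf : continuous f.
  move=> v A [P vP PA]; have FF : Filter (nbhs v) := nbhs_filter v.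
  have : \forall u \near v, forall i (j : 'I_1), P i j (f u i j).
    apply: (@filter_forall _ _ (fun i u => forall j : 'I_1, P i j (f u i j)) _ FF) => i.
    apply: (@filter_forall _ _ (fun j u => P i j (f u i j)) _ FF) => j.
    have := @cplx_continuous _ _ _ (cv (lshift m i)) (cv (rshift m i)) v.
    move=> /(_ (P i j)); have := vP i j; rewrite mxE => Pij /(_ Pij).
    by apply: (@filterS _ _ FF) => u; rewrite mxE.
  by apply: (@filterS _ _ FF) => u; exact: PA.
pose q (v : 'rV[R]_(m + m)) : R := \sum_k v 0 k ^+ 2.
have qf v : nsq (f v) = q v.
  rewrite /nsq /sqnorm sum_coords /q big_split_ord /=.
  by congr (_ + _); apply: eq_bigr => i _; rewrite mxE.
have -> : [set z | nsq z <= c] = f @` [set v | q v <= c].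
  apply/seteqP; split => [z /= zc|_ [v vc <-]]; last by rewrite /= qf.
  pose v : 'rV[R]_(m + m) := \row_k coords z (fintype.split k).
  have fv : f v = z.
    apply/colP => i; rewrite !mxE /v.
    by rewrite (unsplitK (inl _ i)) (unsplitK (inr _ i)); apply: cplx_eq.
  by exists v => //=; rewrite -qf fv.
apply: continuous_compact; first exact: continuous_subspaceT.
(* An entry whose square is at most [c] has modulus at most [c + 1], which fixes the cube. *)
apply: (@subclosed_compact _ _
  [set v : 'rV[R]_(m + m) | forall i, `[- (c + 1), c + 1]%classic (v ord0 i)]).
- have cq : continuous q.
    apply: (@continuous_bigsum _ _ _ (fun k (v : 'rV[R]_(m + m)) => v 0 k ^+ 2)) => k.
    exact: (continuous_mul (cv k) (cv k)).
  exact: ((continuous_closedP q).1 cq _ (@closed_le _ c)).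
- by apply: (@rV_compact _ _ (fun=> `[- (c + 1), c + 1]%classic)) => _; exact: segment_compact.
move=> v /= vc i; rewrite in_itv/=.
have : v ord0 i ^+ 2 <= c.
  apply: le_trans vc; rewrite /q (bigD1 i)//= lerDl sumr_ge0// => k _.
  exact: sqr_ge0.
by move: (v ord0 i) => x xc; apply/andP; split; nra.
Qed.

End ComplexCoordinates.

(** * Exponential decay from repeated expansion, and elementary tools *)

(** By induction, [g t] is at most [2 * B * expR (- c * t)] plus an error, with [expR (c * T) = 2].
    Passing to [r] costs a factor of at most 2 in the exponential but gains 4 in the value, so each
    passage at least halves the error; the a priori bound [M] starts the induction. *)
Lemma halving_decay (R : realType) (g : R -> R) (T M B t : R) :
  0 < T -> 0 <= B -> (forall s, 0 <= s -> g s <= M) ->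
  (forall s, 0 <= s <= T -> g s <= B) ->
  (forall s, T <= s -> exists2 r, `|r - s| <= T & 2 * 2 * g s <= g r) ->
  0 <= t -> g t <= 2 * B * expR (- (ln 2 / T) * t).
Proof.
move=> T0 B0 gM gB half t0.
pose c := ln 2 / T.
have c0 : 0 < c by rewrite divr_gt0// ln_gt0// ltr1n.
have cT : expR (c * T) = 2 by rewrite /c divfK ?gt_eqF// lnK// posrE.
have M0 : 0 <= Num.max M 0 by rewrite le_max lexx orbT.
apply: (@le_geometric _ _ _ (Num.max M 0)) => k.
elim: k t t0 => [|k IH] t t0.
  rewrite expr0 mulr1 (le_trans (gM t t0))//.
  have : M <= Num.max M 0 by rewrite le_max lexx.
  have : 0 <= 2 * B * expR (- c * t) by rewrite !mulr_ge0// expR_ge0.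
  by move: (Num.max M 0) => ?; rewrite -/c; lra.
(* For [t <= T] the exponential is at least one half, so the factor 2 covers the bound [B]. *)
have [tT|Tt] := leP t T.
  apply: (@le_trans _ _ B); first by apply: gB; rewrite t0 tT.
  have h1 : B <= 2 * B * expR (- c * t).
    have e1 : expR (c * t) * expR (- c * t) = 1 by rewrite -expRD mulNr subrr expR0.
    have u2 : expR (c * t) <= 2 by rewrite -cT ler_expR ler_wpM2l// ltW.
    have Bv : 0 <= B * expR (- c * t) by rewrite mulr_ge0// expR_ge0.
    have -> : B = expR (c * t) * (B * expR (- c * t)) by rewrite mulrCA e1 mulr1.
    have := ler_wpM2r Bv u2; rewrite mulrCA e1; lra.
  have : 0 <= Num.max M 0 * 2^-1 ^+ k.+1 by rewrite mulr_ge0// exprn_ge0.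
  rewrite -/c; lra.
have [r rt gr] := half t (ltW Tt).
move: rt; rewrite ler_norml => /andP[r1 r2].
have r0 : 0 <= r by lra.
have := IH r r0; rewrite -/c.
have h : expR (- c * r) <= 2 * expR (- c * t).
  rewrite -cT -expRD ler_expR; nra.
have h' : 2 * B * expR (- c * r) <= 2 * B * (2 * expR (- c * t)).
  by rewrite ler_wpM2l// mulr_ge0.
have : 0 <= Num.max M 0 * 2^-1 ^+ k by rewrite mulr_ge0// exprn_ge0.
have : 0 <= 2 * B * expR (- c * t) by rewrite !mulr_ge0// expR_ge0.
rewrite exprS; lra.
Qed.

(** Among subspaces contained in [P], take one of maximal dimension: adjoining a vector that
    satisfies [P] cannot enlarge it. *)
Lemma vspace_of_pred (F : fieldType) (V : vectType F) (P : V -> Prop) :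
  P 0 -> (forall a x y, P x -> P y -> P (a *: x + y)) ->
  exists L : {vspace V}, forall x, x \in L <-> P x.
Proof.
move=> P0 PD.
pose good d := `[< exists2 L : {vspace V}, {in L, forall x, P x} & \dim L = d >].
have ex : exists d, good d.
  exists 0%N; apply/asboolP; exists 0%VS; last exact: dimv0.
  by move=> x; rewrite memv0 => /eqP ->.
have bound d : good d -> (d <= \dim {:V})%N.
  by move=> /asboolP[L _ <-]; apply: dimvS; exact: subvf.
case: (ex_maxnP ex bound) => d /asboolP[L LP Ld] dmax.
exists L => x; split => [|Px]; first exact: LP.
have : good (\dim (L + <[x]>)).
  apply/asboolP; exists (L + <[x]>)%VS => // y /memv_addP[u uL [v /vlineP[k ->] ->]].
  by rewrite addrC; apply: PD => //; exact: LP.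
move=> /dmax; rewrite -Ld => le.
have : (L == L + <[x]>)%VS by rewrite eqEdim addvSl le.
by move=> /eqP ->; apply: (subvP (addvSr L <[x]>)); exact: memv_line.
Qed.

Lemma cluster_closed (T : topologicalType) (F : set_system T) (B : set T) (p : T) :
  Filter F -> closed B -> F B -> cluster F p -> B p.
Proof. by move=> FF cB FB; rewrite clusterE => /(_ B FB); exact: cB. Qed.

Lemma shift_within (R : realDomainType) (T b c r : R) :
  T < c -> T < b - c -> `|r| <= T -> 0 <= c + r <= b.
Proof. by rewrite ler_norml => ? ? /andP[? ?]; apply/andP; split; lra. Qed.

Lemma le0_of_mul4_le (R : realDomainType) (x y : R) : 2 * 2 * x <= y -> y <= x -> x <= 0.
Proof. lra. Qed.

Lemma exp_decay_le0 (R : realType) (x K c : R) : 0 < c ->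
  (forall t, 0 <= t -> x <= K * expR (- c * t)) -> x <= 0.
Proof.
move=> c0 le; rewrite leNgt; apply/negP => x0.
(* At this time [x * expR (c * t) >= x * (1 + c * t) = x + |K|], which exceeds [K]. *)
pose t := `|K| / x / c.
have t0 : 0 <= t by rewrite !divr_ge0// ltW.
have := ler_wpM2r (expR_ge0 (c * t)) (le t t0).
rewrite -mulrA -expRD mulNr addNr expR0 mulr1 => h.
have h1 := ler_wpM2l (ltW x0) (expR_ge1Dx (c * t)).
have h2 : x * (1 + c * t) = x + `|K| by rewrite /t; field; rewrite !gt_eqF.
have := ler_norm K; rewrite h2 in h1; lra.
Qed.

(** Translates the norm inequalities in the definition of dichotomy into inequalities of squared
    norms. *)
Lemma vnorm_le (R : realType) m m' (x : 'cV[Cplx R]_m) (y : 'cV[Cplx R]_m') (k : R) :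
  0 <= k -> (vnorm x <= k * vnorm y) = (nsq x <= k ^+ 2 * nsq y).
Proof.
move=> k0; rewrite !vnormE -{1}(ger0_norm k0) -sqrtr_sqr -sqrtrM ?sqr_ge0//.
by rewrite ler_sqrt// mulr_ge0 ?sqr_ge0 ?nsq_ge0.
Qed.

Lemma expR_sqr (R : realType) (x : R) : expR x ^+ 2 = expR (2 * x).
Proof. by rewrite expr2 -expRD; congr expR; ring. Qed.

(** * Linear families over a compact flow *)

Section LinearFamily.
Variables (R : realType) (Omega : topologicalType) (sigma : R -> Omega -> Omega).
Local Notation C := (Cplx R).
Variables (m : nat) (A : Omega -> 'M[C]_m).
Hypothesis compact_Omega : compact [set: Omega].
Hypothesis flow_sigma : continuous_flow sigma.
Hypothesis continuous_A : forall k l, continuous (fun w => real_coef (A w) k l).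

Definition orbit_coef (w : Omega) (t : R) := real_coef (A (sigma t w)).

(** Compactness of the base gives one coefficient bound for all orbits, which makes the Gronwall
    estimates uniform in [w]. *)
Lemma real_coef_bounded :
  exists2 M : R, 0 <= M & forall w k l, `|real_coef (A w) k l| <= M.
Proof.
pose g w : R := \sum_k \sum_l `|real_coef (A w) k l|.
have cg : continuous g.
  apply: continuous_bigsum => k; apply: continuous_bigsum => l w.
  by apply: cvg_norm; exact: continuous_A.
have /ex_strict_bound_gt0[M M0 gM] : bounded_set (g @` setT).
  by apply/compact_bounded/continuous_compact => //; exact: continuous_subspaceT.
exists M => [|w k l]; first exact: ltW.
apply: le_trans (ltW (gM (g w) _)); last by exists w.
apply: le_trans (ler_norm _).
rewrite /g (bigD1 k)//= (bigD1 l)//= -addrA lerDl addr_ge0//; apply: sumr_ge0 => // ? _.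
exact: sumr_ge0.
Qed.

Lemma orbit_coef_continuous k l :
  continuous (fun p : Omega * R => orbit_coef p.1 p.2 k l).
Proof.
have [cs _ _] := flow_sigma.
have c1 : continuous (fun p : Omega * R => p.2) by move=> ?; exact: cvg_snd.
have c2 : continuous (fun p : Omega * R => p.1) by move=> ?; exact: cvg_fst.
move=> p; have h1 := continuous_comp (continuous_pair c1 c2 (x := p)) (cs (p.2, p.1)).
exact: (continuous_comp h1 (@continuous_A k l (sigma p.2 p.1))).
Qed.

Lemma is_solutionP w (z : R -> 'cV[C]_m) :
  is_solution sigma A w z <-> linear_solution (orbit_coef w) (fun t => coords (z t)).
Proof.
split=> [h t k|h t i j].
  by rewrite -coords_mul; case: k => i; [case: (h t i 0)|case: (h t i 0)].
rewrite ord1; split.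
  by have := h t (inl i); rewrite -coords_mul.
by have := h t (inr i); rewrite -coords_mul.
Qed.

(** The columns are the solutions starting at the standard basis vectors, selected by choice for all
    [w] and [j] at once. *)
Lemma fundamental_matrix_exists : exists U, fundamental_matrix sigma A U.
Proof.
have [M M0 AM] := real_coef_bounded.
have ex (w : Omega) (j : 'I_m) : exists z : R -> 'cV[C]_m,
    z 0 = delta_mx j 0 /\ is_solution sigma A w z.
  have [||x x0 sx] := @linear_existence R _ (orbit_coef w) M (coords (delta_mx j 0)) M0.
  - by move=> s k l; exact: AM.
  - move=> k l s.
    have c1 : continuous (fun _ : R => w) by move=> ?; exact: cvg_cst.
    have c2 : continuous (fun s : R => s) by move=> ?; exact: cvg_id.
    exact: (continuous_comp (continuous_pair c1 c2 (x := s))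
      (@orbit_coef_continuous k l (w, s))).
  exists (fun t => of_coords (x t)); split.
    by apply: coords_inj => k; rewrite of_coordsK x0.
  apply/is_solutionP; have -> : (fun t => coords (of_coords (x t))) = x => //.
  by apply/funext => t; apply/funext => k; rewrite of_coordsK.
have /choice[Z hZ] : forall p : Omega * 'I_m, exists z : R -> 'cV[C]_m,
    z 0 = delta_mx p.2 0 /\ is_solution sigma A p.1 z by move=> p; exact: ex.
exists (fun t w => \matrix_(i, j) Z (w, j) t i 0) => w; split.
  by apply/matrixP => i j; rewrite !mxE (hZ (w, j)).1 mxE eqxx andbT.
move=> t i j; have := (hZ (w, j)).2 t i 0.
have -> : (A (sigma t w) *m \matrix_(i, j) Z (w, j) t i 0) i j =
          (A (sigma t w) *m Z (w, j) t) i 0.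
  by rewrite !mxE; apply: eq_bigr => k _; rewrite mxE.
under [in X in _ -> X]eq_fun do rewrite mxE.
by under [in X in _ -> _ /\ X]eq_fun do rewrite mxE.
Qed.

(** * Cocycle property, growth and continuity of the propagator *)

Section Propagator.
Variable U : R -> Omega -> 'M[C]_m.
Hypothesis fundamental_U : fundamental_matrix sigma A U.

Lemma propagator_solution w (z : 'cV[C]_m) : is_solution sigma A w (fun t => U t w *m z).
Proof.
move=> t i j; have [_ /(_ t) dU] := fundamental_U w.
have E s : (U s w *m z) i j = \sum_k U s w i k * z k j by rewrite mxE.
have -> : (A (sigma t w) *m (U t w *m z)) i j =
    \sum_k (A (sigma t w) *m U t w) i k * z k j by rewrite mulmxA mxE.
split.
  under eq_fun do rewrite E re_sum.
  rewrite re_sum; apply: is_derive_bigsum => k.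
  under eq_fun do rewrite re_mul.
  rewrite re_mul; apply: is_derive_sub.
    apply: is_derive_eq (is_derive_mul (dU i k).1 (is_derive_const (re (z k j)) t)) _.
    by rewrite mulr0 addr0.
  apply: is_derive_eq (is_derive_mul (dU i k).2 (is_derive_const (im (z k j)) t)) _.
  by rewrite mulr0 addr0.
under eq_fun do rewrite E im_sum.
rewrite im_sum; apply: is_derive_bigsum => k.
under eq_fun do rewrite im_mul.
rewrite im_mul; apply: is_derive_add.
  apply: is_derive_eq (is_derive_mul (dU i k).1 (is_derive_const (im (z k j)) t)) _.
  by rewrite mulr0 addr0.
apply: is_derive_eq (is_derive_mul (dU i k).2 (is_derive_const (re (z k j)) t)) _.
by rewrite mulr0 addr0.
Qed.

Lemma solution_propagator w z t : is_solution sigma A w z -> z t = U t w *m z 0.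
Proof.
move=> sz; have [M M0 AM] := real_coef_bounded.
apply: coords_inj.
apply: (linear_uniqueness M0 (a := orbit_coef w)
  (x := fun t => coords (z t)) (y := fun t => coords (U t w *m z 0))).
- by move=> s k l; exact: AM.
- exact/is_solutionP.
- exact/is_solutionP/propagator_solution.
- by move=> k; rewrite (fundamental_U w).1 mul1mx.
Qed.

Lemma propagator0 w : U 0 w = 1%:M.
Proof. by case: (fundamental_U w). Qed.

Lemma solution_shift w z s : is_solution sigma A w z ->
  is_solution sigma A (sigma s w) (fun t => z (t + s)).
Proof.
have [_ _ sD] := flow_sigma.
move=> sz t i j; have [d1 d2] := sz (t + s) i j; rewrite -sD.
have d0 : is_derive t (1 : R) (fun u : R => u + s) 1.
  by rewrite -[X in is_derive _ _ _ X]addr0; exact: is_derive_add (is_derive_const _ _).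
split.
  by rewrite -[X in is_derive _ _ _ X]mulr1;
    exact: (@is_derive1_comp R (fun u => re (z u i j)) (fun u => u + s) t _ _ d1 d0).
by rewrite -[X in is_derive _ _ _ X]mulr1;
    exact: (@is_derive1_comp R (fun u => im (z u i j)) (fun u => u + s) t _ _ d2 d0).
Qed.

(** A time-shifted solution solves the system based at [sigma s w], so uniqueness gives the cocycle
    identity. *)
Lemma propagatorD w (z : 'cV[C]_m) s t : U (t + s) w *m z = U t (sigma s w) *m (U s w *m z).
Proof.
have := solution_propagator t (solution_shift s (propagator_solution w z)).
by rewrite add0r.
Qed.

Lemma propagatorK w (z : 'cV[C]_m) s : U (- s) (sigma s w) *m (U s w *m z) = z.
Proof. by rewrite -propagatorD addNr propagator0 mul1mx. Qed.

Lemma propagator_growth : exists2 c : R, 0 < c &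
  forall w (z : 'cV[C]_m) t, nsq (U t w *m z) <= expR (c * `|t|) * nsq z.
Proof.
have [M M0 AM] := real_coef_bounded.
exists (growth_rate ('I_m + 'I_m)%type M); first exact: growth_rate_gt0.
move=> w z t; rewrite mulrC.
have := @linear_growth R _ (orbit_coef w) (fun t => coords (U t w *m z)) M t M0.
rewrite propagator0 mul1mx; apply; first by move=> s k l; exact: AM.
exact/is_solutionP/propagator_solution.
Qed.

(** Continuous dependence, applied to basis vectors, makes the matrix entries continuous in [w];
    linearity in the vector then gives joint continuity. *)
Lemma propagator_coords_continuous t k :
  continuous (fun p : Omega * 'cV[C]_m => coords (U t p.1 *m p.2) k).
Proof.
have [M M0 AM] := real_coef_bounded.
have cU (z : 'cV[C]_m) i : continuous (fun w => coords (U t w *m z) i).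
  apply: (@linear_continuous_dependence R _ Omega orbit_coef M (coords z)
    (fun w t => coords (U t w *m z)) M0).
  - by move=> w s i' j; exact: AM.
  - exact: orbit_coef_continuous.
  - by move=> w; exact/is_solutionP/propagator_solution.
  - by move=> w k'; rewrite propagator0 mul1mx.
have Ucol w i j : U t w i j = (U t w *m delta_mx j (0 : 'I_1)) i 0.
  by rewrite -colE mxE.
have cUc k' l : continuous (fun w => real_coef (U t w) k' l).
  by case: k' l => i [] j /=; under eq_fun do rewrite Ucol;
    [exact: (cU _ (inl i))|move=> w; apply: cvgN; exact: (cU _ (inr i))
    |exact: (cU _ (inr i))|exact: (cU _ (inl i))].
have c2 l : continuous (fun p : Omega * 'cV[C]_m => coords p.2 l).
  by move=> p; apply: (continuous_comp _ (@coords_continuous R m l p.2)); exact: cvg_snd.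
under eq_fun do rewrite coords_mul.
apply: continuous_bigsum => l; apply: continuous_mul => // p.
by apply: (continuous_comp _ (@cUc k l p.1)); exact: cvg_fst.
Qed.

Lemma propagator_nsq_continuous t :
  continuous (fun p : Omega * 'cV[C]_m => nsq (U t p.1 *m p.2)).
Proof.
apply: continuous_bigsum => k.
have ck := @propagator_coords_continuous t k.
exact: (continuous_mul ck ck).
Qed.

(** * Uniform expansion in the absence of bounded orbits *)

Definition no_bounded_orbit :=
  forall w (z : 'cV[C]_m) M, (forall t, nsq (U t w *m z) <= M) -> z = 0.

(** A unit vector whose squared norm never exceeded 4 would have a bounded orbit. Exceeding 4 at a
    given time is an open condition, so compactness of the unit sphere bundle yields one [T];
    homogeneity covers the other vectors. *)
Lemma uniform_expansion : no_bounded_orbit -> exists2 T : R, 0 < T &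
  forall w (z : 'cV[C]_m), exists2 t, `|t| <= T & 2 * 2 * nsq z <= nsq (U t w *m z).
Proof.
move=> nb.
pose K := [set: Omega] `*` [set z : 'cV[C]_m | nsq z = 1].
have cS : compact [set z : 'cV[C]_m | nsq z = 1].
  apply: (subclosed_compact _ (@compact_nsq_le R m 1)).
    exact: ((continuous_closedP _).1 (@nsq_continuous R m) _ (@closed_eq _ 1)).
  by move=> z /= ->.
have /compact_near_coveringP cK : compact K by exact: compact_setX.
pose P (T : R) (p : Omega * 'cV[C]_m) :=
  exists2 t, `|t| <= T & 2 * 2 < nsq (U t p.1 *m p.2).
have PT : \forall T \near +oo%R, K `<=` P T.
  apply: cK => -[w z] [_ /= z1].
  have [t tz] : exists t, 2 * 2 < nsq (U t w *m z).
    apply: contrapT => /forallNP nt.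
    have z0 : z = 0 by apply: (nb w z (2 * 2)) => t; rewrite leNgt; exact/negP.
    by move/eqP: z1; rewrite z0 nsq0 eq_sym oner_eq0.
  have nt : nbhs (w, z) [set p | 2 * 2 < nsq (U t p.1 *m p.2)].
    have := @propagator_nsq_continuous t; move=> /(_ (w, z) [set y | 2 * 2 < y]); apply.
    exact: lt_nbhsr.
  exists ([set p | 2 * 2 < nsq (U t p.1 *m p.2)], [set T | `|t| <= T]).
    by split=> //=; apply: nbhs_pinfty_ge; rewrite num_real.
  by move=> [p T] [/= h1 h2]; exists t.
have [T [KT T1]] := filter_ex (filterI PT (nbhs_pinfty_ge (num_real (1 : R)))).
exists T => [|w z]; first exact: lt_le_trans T1.
have [->|z0] := eqVneq z 0.
  exists 0; first by rewrite normr0 (le_trans _ T1).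
  by rewrite mulmx0 nsq0 mulr0.
have [c c0 cE] := nsq_normalize z0.
have n0 : 0 < nsq z.
  by rewrite lt0r nsq_ge0 andbT; apply: contra_neq z0; exact: nsq0_eq0.
have [|t tT] := KT (w, toC c *: z).
  by split => //=; have := cE 1%:M; rewrite !mul1mx divff ?gt_eqF.
rewrite /= cE ltr_pdivlMr// => /ltW h.
by exists t.
Qed.

(** * Bounded half-orbits and limit sets *)

(** The boolean selects the direction of time, [false] for forward and [true] for backward, so that
    both ends share their proofs. *)
Definition half_orbit_bounded (b : bool) w (z : 'cV[C]_m) :=
  exists M, forall t, 0 <= t -> nsq (U ((-1) ^+ b * t) w *m z) <= M.

(** From a time at least [T], the expansion time stays on the same half-orbit, so [halving_decay]
    applies. The bound on [[0, T]] comes from [propagator_growth], so the constants do not depend on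
    [w] or [z]. *)
Lemma half_orbit_decay : no_bounded_orbit -> exists K c : R,
  [/\ 1 <= K, 0 < c & forall b w (z : 'cV[C]_m), half_orbit_bounded b w z ->
    forall t, 0 <= t ->
    nsq (U ((-1) ^+ b * t) w *m z) <= K * expR (- c * t) * nsq z].
Proof.
move=> nb; have [T T0 exT] := uniform_expansion nb.
have [L L0 grow] := propagator_growth.
exists (2 * expR (L * T)), (ln 2 / T); split.
- suff : 1 <= expR (L * T) by lra.
  by rewrite -expR0 ler_expR mulr_ge0 ?ltW.
- by rewrite divr_gt0// ln_gt0// ltr1n.
move=> b w z [M zM] t t0.
have := @halving_decay R (fun t => nsq (U ((-1) ^+ b * t) w *m z)) T M
  (expR (L * T) * nsq z) t T0 _ zM _ _ t0.
rewrite mulrA mulrAC; apply.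
- by rewrite mulr_ge0 ?expR_ge0 ?nsq_ge0.
- move=> s /andP[s0 sT]; apply: le_trans (grow _ _ _) _.
  rewrite ler_wpM2r ?nsq_ge0// ler_expR ler_wpM2l ?(ltW L0)//.
  by rewrite normrMsign ger0_norm.
move=> s Ts.
have [r rT rz] := exT (sigma ((-1) ^+ b * s) w) (U ((-1) ^+ b * s) w *m z).
(* The expansion time is measured along the flow; the sign converts it to the parameter of the
   half-orbit without changing its modulus. *)
exists (s + (-1) ^+ b * r); first by rewrite addrAC subrr add0r normrMsign.
have -> : (-1) ^+ b * (s + (-1) ^+ b * r) = r + (-1) ^+ b * s.
  by rewrite mulrDr signrMK addrC.
by rewrite propagatorD.
Qed.

Lemma half_orbit_bounded_vspace : exists L : bool -> Omega -> {vspace 'cV[C]_m},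
  forall b w z, z \in L b w <-> half_orbit_bounded b w z.
Proof.
have ex (p : bool * Omega) : exists L : {vspace 'cV[C]_m},
    forall z, z \in L <-> half_orbit_bounded p.1 p.2 z.
  apply: vspace_of_pred.
    by exists 0 => t _; rewrite mulmx0 nsq0.
  move=> a x y [M xM] [N yN].
  exists (2 * ((re a ^+ 2 + im a ^+ 2) * M) + 2 * N) => t t0.
  rewrite mulmxDr -scalemxAr; apply: le_trans (nsq_add _ _) _.
  rewrite nsq_scale lerD// ler_wpM2l//; last exact: yN.
  by rewrite ler_wpM2l ?addr_ge0 ?sqr_ge0//; exact: xM.
have [L hL] := choice ex.
by exists (fun b w => L (b, w)) => b w z; exact: (hL (b, w)).
Qed.

(* If [L b w] had dimension < d, a complement would meet every [E k], and a cluster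
   point of unit vectors of the intersections would have a bounded half-orbit. *)
Lemma half_orbit_bounded_dim (L : {vspace 'cV[C]_m}) b w (d : nat) (K : R)
    (E : nat -> {vspace 'cV[C]_m}) :
  (forall z, half_orbit_bounded b w z -> z \in L) ->
  (forall k, (d <= \dim (E k))%N) ->
  (forall k z t, z \in E k -> 0 <= t <= k%:R ->
     nsq (U ((-1) ^+ b * t) w *m z) <= K * nsq z) ->
  (d <= \dim L)%N.
Proof.
move=> LP dE EK; rewrite leqNgt; apply/negP => Ld.
have /choice[z hz] : forall k, exists z : 'cV[C]_m,
    [/\ z \in E k, z \in (L^C)%VS & nsq z = 1].
  move=> k.
  have cap0 : (E k :&: L^C)%VS != 0%VS.
    rewrite -dimv_eq0 -lt0n.
    have h1 := dimv_sum_cap (E k) (L^C)%VS.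
    have h2 : (\dim (E k + L^C)%VS <= m)%N.
      by apply: leq_trans (dimvS (subvf _)) _; rewrite dimvf /dim /= muln1.
    have h3 : \dim (L^C)%VS = (m - \dim L)%N by rewrite dimv_compl dimvf /dim /= muln1.
    have h4 := dE k; have h5 : (\dim L <= m)%N.
      by apply: leq_trans (dimvS (subvf _)) _; rewrite dimvf /dim /= muln1.
    lia.
  have [c c0 cE] := nsq_normalize (m := m) (z := vpick (E k :&: L^C)%VS)
    ltac:(by rewrite vpick0).
  have n0 : nsq (vpick (E k :&: L^C)%VS) != 0.
    by apply/eqP => /nsq0_eq0/eqP; rewrite vpick0 (negbTE cap0).
  exists (toC c *: vpick (E k :&: L^C)%VS); have := memv_pick (E k :&: L^C)%VS.
  rewrite memv_cap => /andP[h1 h2]; split; try exact: memvZ.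
  by have := cE 1%:M; rewrite !mul1mx divff.
have FP : ProperFilter (z k @[k --> \oo]) by exact: fmap_proper_filter.
have [|p [_ clp]] := @compact_nsq_le R m 1 (z k @[k --> \oo]) FP.
  by exists 0%N => // k _ /=; have [_ _ ->] := hz k.
have FF : Filter (z k @[k --> \oo]) by exact: filter_filter.
have p1 : nsq p = 1.
  apply: (cluster_closed (B := [set z | nsq z = 1]) FF _ _ clp).
    exact: ((continuous_closedP _).1 (@nsq_continuous R m) _ (@closed_eq _ 1)).
  by exists 0%N => // k _ /=; have [_ _ ->] := hz k.
have pLC : p \in (L^C)%VS.
  apply: (cluster_closed (B := [set z | z \in (L^C)%VS]) FF (@closed_vspace _ _ _) _ clp).
  by exists 0%N => // k _ /=; have [] := hz k.
have pL : p \in L.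
  apply: LP; exists K => t t0.
  apply: (cluster_closed (B := [set z | nsq (U ((-1) ^+ b * t) w *m z) <= K]) FF _ _ clp).
    exact: ((continuous_closedP _).1 (@nsq_mulmx_continuous _ _ _) _ (@closed_le _ K)).
  exists (Num.bound t) => // k /= tk; have [zE _ z1] := hz k.
  have := EK k (z k) t zE; rewrite z1 mulr1; apply; rewrite t0 /=.
  by apply: le_trans (ltW (archi_boundP t0)) _; rewrite ler_nat.
have : p \in (L :&: L^C)%VS by rewrite memv_cap pL.
rewrite capv_compl memv0 => /eqP p0.
by move/eqP: p1; rewrite p0 nsq0 eq_sym oner_eq0.
Qed.

Lemma orbit_nsq_continuous b w (z : 'cV[C]_m) :
  continuous (fun t : R => nsq (U ((-1) ^+ b * t) w *m z)).
Proof.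
have /is_solutionP sz := propagator_solution w z.
apply: continuous_bigsum => k.
have ck : continuous (fun t : R => coords (U ((-1) ^+ b * t) w *m z) k).
  apply: is_derive_continuous => t.
  exact: (is_derive_compM (f := fun t => coords (U t w *m z) k) (sz _ k)).
exact: (continuous_mul ck ck).
Qed.

(** Compactness gives a cluster point of the orbit at the chosen end. Its whole orbit inherits the
    bound, and since a fixed time shift does not change the limit of [Q], the value of [Q] is
    constant on it. *)
Lemma omega_limit b w (z : 'cV[C]_m) M (Q : 'cV[C]_m -> R) q :
  (forall t, continuous (fun p : Omega * 'cV[C]_m => Q (U t p.1 *m p.2))) ->
  (forall t, nsq (U t w *m z) <= M) ->
  Q (U ((-1) ^+ b * t) w *m z) @[t --> +oo] --> q ->
  exists w' z', (forall t, nsq (U t w' *m z') <= M) /\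
                (forall t, Q (U t w' *m z') = q).
Proof.
move=> cQ zM Qq.
pose f (t : R) := (sigma ((-1) ^+ b * t) w, U ((-1) ^+ b * t) w *m z).
have FP : ProperFilter (f t @[t --> +oo]) by exact: fmap_proper_filter.
have cK : compact ([set: Omega] `*` [set z : 'cV[C]_m | nsq z <= M]).
  by apply: compact_setX => //; exact: compact_nsq_le.
have [|[w' z'] [_ clp]] := cK (f t @[t --> +oo]) FP.
  by exists 0; split => // t _ /=; split.
have FF : Filter (f t @[t --> +oo]) by exact: filter_filter.
exists w', z'; split => t.
  apply: (cluster_closed (B := [set p | nsq (U t p.1 *m p.2) <= M]) FF _ _ clp).
    exact: ((continuous_closedP _).1 (@propagator_nsq_continuous t) _ (@closed_le _ M)).
  by exists 0; split => // s _ /=; rewrite -propagatorD.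
apply/eqP; rewrite -subr_eq0 -normr_le0; apply/ler_addgt0Pr => e e0; rewrite add0r.
apply: (cluster_closed (B := [set p | `|Q (U t p.1 *m p.2) - q| <= e]) FF _ _ clp).
  have ce : continuous (fun p : Omega * 'cV[C]_m => `|Q (U t p.1 *m p.2) - q|).
    move=> p; apply: cvg_norm; apply: cvgB; first exact: cQ.
    exact: cst_continuous.
  exact: ((continuous_closedP _).1 ce _ (@closed_le _ e)).
move/cvgrPdist_le : Qq => /(_ e e0) [s0 [s0r Hs]].
(* Beyond this threshold a shift by [t] in either direction stays beyond [s0]. *)
exists (s0 + `|t|); split; first by rewrite num_real.
move=> s /= ss; rewrite -propagatorD.
have := Hs (s + (-1) ^+ b * t).
have -> : (-1) ^+ b * (s + (-1) ^+ b * t) = t + (-1) ^+ b * s.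
  by rewrite mulrDr signrMK addrC.
rewrite (distrC q); apply.
have : `|(-1) ^+ b * t| = `|t| by rewrite normrMsign.
move: ((-1) ^+ b * t) => u ut; have := ler_norm (- u); rewrite normrN ut; lra.
Qed.

(** * Monotone functions along orbits *)

Section Lyapunov.
Variable Q : 'cV[C]_m -> R.
Hypothesis Q_continuous :
  forall t, continuous (fun p : Omega * 'cV[C]_m => Q (U t p.1 *m p.2)).
Hypothesis Q_nondecreasing :
  forall w z, nondecreasing_fun (fun t => Q (U t w *m z)).
Hypothesis Q_bounded : exists2 B, 0 <= B & forall z, `|Q z| <= B * nsq z.

(** Along a bounded orbit [Q] is monotone and bounded. On limit points at either end it is constant,
    so these vanish and both limits are 0; monotonicity forces [Q] to be 0 throughout, and the
    hypothesis applies to [z] itself. *)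
Lemma lyapunov_no_bounded_orbit :
  (forall w (z : 'cV[C]_m) M q, (forall t, nsq (U t w *m z) <= M) ->
     (forall t, Q (U t w *m z) = q) -> z = 0) ->
  no_bounded_orbit.
Proof.
have [B B0 QB] := Q_bounded.
have Q0 : Q 0 = 0.
  by apply/eqP; rewrite -normr_le0; have := QB 0; rewrite nsq0 mulr0.
move=> Qz w z M zM.
have QM t : `|Q (U t w *m z)| <= B * M.
  by apply: le_trans (QB _) _; rewrite ler_wpM2l.
apply: (Qz w z M 0 zM) => t; apply/eqP; rewrite eq_le; apply/andP; split.
  (* At the forward end the limit is the supremum of [Q] along the orbit; its vanishing gives
     [Q <= 0]. *)
  have ub : has_ubound (range (fun t => Q (U t w *m z))).
    by exists (B * M) => _ [s _ <-]; apply: le_trans (ler_norm _) (QM s).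
  have cv := nondecreasing_cvgr (Q_nondecreasing w z) ub.
  have QE : (fun t => Q (U ((-1) ^+ false * t) w *m z)) = (fun t => Q (U t w *m z)).
    by apply/funext => s; rewrite expr0 mul1r.
  move: cv; set q := sup _; rewrite -QE => cv.
  have [w' [z' [z'M z'Q]]] := omega_limit Q_continuous zM cv.
  have z'0 := Qz w' z' M _ z'M z'Q.
  have := z'Q 0; rewrite z'0 mulmx0 Q0 => ->.
  by apply: sup_upper_bound; [split => //; exists (Q (U t w *m z)), t|exists t].
(* The backward end is treated through [- Q] in reversed time, which is again nondecreasing and
   gives [0 <= Q]. *)
have nd : nondecreasing_fun (fun t => - Q (U (- t) w *m z)).
  by move=> s r sr; rewrite lerN2; apply: Q_nondecreasing; rewrite lerN2.
have ub : has_ubound (range (fun t => - Q (U (- t) w *m z))).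
  exists (B * M) => _ [s _ <-]; apply: le_trans (ler_norm _) _.
  by rewrite normrN.
have cv := nondecreasing_cvgr nd ub.
have cQ t' : continuous (fun p : Omega * 'cV[C]_m => - Q (U t' p.1 *m p.2)).
  by move=> p; apply: cvgN; exact: Q_continuous.
have QE : (fun t => - Q (U ((-1) ^+ true * t) w *m z)) = (fun t => - Q (U (- t) w *m z)).
  by apply/funext => s; rewrite expr1 mulN1r.
move: cv; set q := sup _; rewrite -QE => cv.
have [w' [z' [z'M z'Q]]] := omega_limit (Q := fun z => - Q z) cQ zM cv.
have z'0 : z' = 0.
  by apply: (Qz w' z' M (- q) z'M) => s; rewrite -(z'Q s) opprK.
rewrite -oppr_le0.
have := z'Q 0; rewrite z'0 mulmx0 Q0 oppr0 => ->.
apply: sup_upper_bound; first by split => //; exists (- Q (U (- 0) w *m z)), 0.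
by exists (- t); rewrite ?opprK.
Qed.

(** The spaces [E k] of data that reach [N b] at signed time [k] satisfy a bound on [[0, k]] uniform
    in [k], as [half_orbit_bounded_dim] demands. It is checked at the time [c] where the solution is
    largest. *)
Lemma lyapunov_half_orbit_dim (L : bool -> Omega -> {vspace 'cV[C]_m}) (d : nat)
    (N : bool -> {vspace 'cV[C]_m}) (e : R) :
  no_bounded_orbit ->
  (forall b w z, half_orbit_bounded b w z -> z \in L b w) ->
  (forall b, (d <= \dim (N b))%N) -> 0 < e ->
  (forall b z, z \in N b -> (-1) ^+ b * Q z <= - (e * nsq z)) ->
  forall b w, (d <= \dim (L b w))%N.
Proof.
move=> nb LP dN e0 QN b w.
have [B B0 QB] := Q_bounded.
have [T T0 exT] := uniform_expansion nb.
have [l l0 grow] := propagator_growth.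
pose G := expR (l * T); have G0 : 0 <= G by exact: expR_ge0.
pose back (k : nat) := U (- ((-1) ^+ b * k%:R)) (sigma ((-1) ^+ b * k%:R) w).
have backK k (y : 'cV[C]_m) : U ((-1) ^+ b * k%:R) w *m (back k *m y) = y.
  have [_ s0 sD] := flow_sigma.
  have := propagatorK (sigma ((-1) ^+ b * k%:R) w) y (- ((-1) ^+ b * k%:R)).
  by rewrite opprK -sD addrC addrN s0.
pose E (k : nat) := (linfun (mulmx (back k)) @: N b)%VS.
apply: (@half_orbit_bounded_dim _ b w d (G + G * (B / e)) E (LP b w)) => k.
  rewrite /E limg_dim_eq; first exact: dN.
  apply/eqP; rewrite -subv0; apply/subvP => y; rewrite memv_cap memv_ker lfunE /=.
  by move=> /andP[_ /eqP y0]; rewrite memv0 -(backK k y) y0 mulmx0.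
move=> z t /memv_imgP[y yN ->]; rewrite lfunE /=; set z' := back k *m y.
move=> tk.
pose g t := nsq (U ((-1) ^+ b * t) w *m z').
have [|c] := @EVT_max R g 0 k%:R (ler0n _ _).
  exact/continuous_subspaceT/orbit_nsq_continuous.
rewrite in_itv/= => /andP[c0 ck] gmax.
have gt : g t <= g c by apply: gmax; rewrite in_itv.
rewrite -/(g t); apply: le_trans gt _.
have n0 := nsq_ge0 z'.
have Bn : 0 <= B / e * nsq z' by rewrite mulr_ge0// divr_ge0// ltW.
have GBn : 0 <= G * (B / e * nsq z') by exact: mulr_ge0.
have Gn : 0 <= G * nsq z' by exact: mulr_ge0.
rewrite mulrDl -mulrA.
have growT s r : `|s - r| <= T -> g s <= G * g r.
  move=> sr; rewrite /g -[X in U X](subrK ((-1) ^+ b * r)) propagatorD.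
  apply: le_trans (grow _ _ _) _; rewrite ler_wpM2r ?nsq_ge0// /G ler_expR.
  by rewrite ler_wpM2l ?(ltW l0)// -mulrBr normrMsign.
have g0 : g 0 = nsq z' by rewrite /g mulr0 propagator0 mul1mx.
(* Maximum near the start: growth over a time at most [T] bounds it by the initial size. *)
have [cT|Tc] := leP c T.
  have := growT c 0; rewrite subr0 g0 ger0_norm// => /(_ cT) h.
  by apply: le_trans h _; rewrite lerDl.
(* Maximum near the end: it is bounded by the final size, and [e * nsq y <= - (-1) ^+ b * Q y <= -
   (-1) ^+ b * Q z' <= B * nsq z'] by definiteness and monotonicity. *)
have [kcT|Tkc] := leP (k%:R - c) T.
  have gk : g k%:R = nsq y by rewrite /g backK.
  have := growT c k%:R; rewrite distrC ger0_norm ?subr_ge0// gk => /(_ kcT) h.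
  suff h' : nsq y <= B / e * nsq z'.
    by apply: le_trans h (le_trans (ler_wpM2l G0 h') _); rewrite lerDr.
  rewrite mulrAC ler_pdivlMr// mulrC.
  have Qzy : (-1) ^+ b * Q z' <= (-1) ^+ b * Q y.
    rewrite -[y in X in _ <= X](backK k) -/z' -{1}[z']mul1mx -(propagator0 w).
    case: (b) => /=; last first.
      by rewrite !expr0 !mul1r; apply: Q_nondecreasing; rewrite ler0n.
    by rewrite !expr1 !mulN1r lerN2; apply: Q_nondecreasing; rewrite oppr_le0 ler0n.
  have := QB z'; rewrite -(normrMsign b) => /ler_normlP[h1 _].
  apply: le_trans h1; rewrite lerNr.
  exact: le_trans Qzy (QN b y yN).
(* Maximum in the middle: the expansion time falls inside [[0, k]], so four times the maximum is at
   most the maximum, which is therefore at most 0. *)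
have [r rT] := exT (sigma ((-1) ^+ b * c) w) (U ((-1) ^+ b * c) w *m z').
rewrite -propagatorD -/(g c).
have -> : r + (-1) ^+ b * c = (-1) ^+ b * (c + (-1) ^+ b * r).
  by rewrite mulrDr signrMK addrC.
rewrite -/(g _) => h.
have gc : g (c + (-1) ^+ b * r) <= g c.
  by apply: gmax; rewrite in_itv/=; apply: (shift_within Tc Tkc); rewrite normrMsign.
apply: le_trans (addr_ge0 Gn GBn); exact: le0_of_mul4_le h gc.
Qed.

End Lyapunov.

(** * Bounded half-orbits and exponential dichotomy *)

(** Moving the starting point adds at most a stretch of duration [|t|], on which the growth estimate
    gives a bound. *)
Lemma half_orbit_bounded_propagate b w (z : 'cV[C]_m) t :
  half_orbit_bounded b w z -> half_orbit_bounded b (sigma t w) (U t w *m z).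
Proof.
move=> [M zM]; have [l l0 grow] := propagator_growth.
exists (Num.max M (expR (l * `|t|) * nsq z)) => r r0; rewrite -propagatorD le_max.
have -> : (-1) ^+ b * r + t = (-1) ^+ b * (r + (-1) ^+ b * t).
  by rewrite mulrDr signrMK.
have [u0|u0] := leP 0 (r + (-1) ^+ b * t); first by rewrite zM.
apply/orP; right; apply: le_trans (grow _ _ _) _.
rewrite ler_wpM2r ?nsq_ge0// ler_expR ler_wpM2l ?(ltW l0)// normrMsign ltr0_norm//.
rewrite opprD; apply: le_trans (_ : - ((-1) ^+ b * t) <= _).
  by rewrite gerDr oppr_le0.
by apply: le_trans (ler_norm _) _; rewrite normrN normrMsign.
Qed.

(** The two fibers meet in 0, and each has dimension at least [n] in a space of dimension [n + n];
    hence both dimensions are [n] and the fibers are complementary. *)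
Lemma dichotomy_of_half_orbits n (L : bool -> Omega -> {vspace 'cV[C]_m}) :
  m = (n + n)%N -> no_bounded_orbit ->
  (forall b w z, z \in L b w <-> half_orbit_bounded b w z) ->
  (forall b w, (n <= \dim (L b w))%N) ->
  exponential_dichotomy sigma A.
Proof.
move=> mn nb LP nL.
have [K [c [K1 c0 KL]]] := half_orbit_decay nb.
have K0 : 0 <= K by exact: le_trans ler01 K1.
have capL w : (L false w :&: L true w)%VS = 0%VS.
  apply/eqP; rewrite -subv0; apply/subvP => z; rewrite memv_cap memv0.
  move=> /andP[/LP[M zM] /LP[M' zM']]; apply/eqP; apply: (nb w z (Num.max M M')) => t.
  rewrite le_max; have [t0|t0] := leP 0 t.
    by have := zM t t0; rewrite expr0 mul1r => ->.
  by have := zM' (- t); rewrite expr1 mulN1r opprK => ->; rewrite ?orbT// oppr_ge0 ltW.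
have dimT : \dim {:'cV[C]_m} = (n + n)%N by rewrite dimvf /dim /= muln1.
have dimL w : \dim (L false w + L true w) = (\dim (L false w) + \dim (L true w))%N.
  by rewrite -dimv_sum_cap capL dimv0 addn0.
have le2 w : (\dim (L false w) + \dim (L true w) <= n + n)%N.
  by rewrite -dimL -dimT; exact: dimvS (subvf _).
have dimLn b w : \dim (L b w) = n.
  by have := le2 w; have := nL false w; have := nL true w; case: b; lia.
(* The square root and the halved rate pass from squared norms to norms. *)
have decay b w z t : z \in L b w -> 0 <= t ->
    vnorm (U ((-1) ^+ b * t) w *m z) <= Num.sqrt K * expR (- (c / 2) * t) * vnorm z.
  move=> /LP zL t0; rewrite vnorm_le ?mulr_ge0 ?sqrtr_ge0 ?expR_ge0//.
  rewrite exprMn sqr_sqrtr// expR_sqr.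
  have -> : 2 * (- (c / 2) * t) = - c * t by field.
  exact: KL.
exists U; first exact: fundamental_U.
exists (Num.sqrt K), (c / 2), (L false), (L true); split.
- split; last exact: divr_gt0.
  by rewrite -sqrtr1 ler_sqrt.
- have cl b : closed_subbundle (L b).
    split; last by move=> w; apply: filterE => w'; rewrite !dimLn.
    (* The uniform decay estimates are closed conditions that cut out the total space: conversely,
       they bound the half-orbit. *)
    have -> : [set p : Omega * 'cV[C]_m | p.2 \in L b p.1] =
        \bigcap_(t in [set t | 0 <= t]) [set p | nsq (U ((-1) ^+ b * t) p.1 *m p.2) -
           K * expR (- c * t) * nsq p.2 <= 0].
      apply/seteqP; split => [[w z] /= /LP zL t /= t0|[w z] /= zL].
        by rewrite subr_le0; exact: KL.
      apply/LP; exists (K * nsq z) => t t0; have := zL t t0.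
      rewrite /= subr_le0 => /le_trans; apply; rewrite mulrAC ler_piMr//.
        by rewrite mulr_ge0 ?nsq_ge0.
      by rewrite -expR0 ler_expR mulNr oppr_le0 mulr_ge0// ltW.
    apply: closed_bigI => t _.
    have ct : continuous (fun p : Omega * 'cV[C]_m =>
        nsq (U ((-1) ^+ b * t) p.1 *m p.2) - K * expR (- c * t) * nsq p.2).
      apply: continuous_sub; first exact: propagator_nsq_continuous.
      apply: continuous_mul; first exact: cst_continuous.
      move=> p; apply: (continuous_comp _ (@nsq_continuous R m p.2)); exact: cvg_snd.
    exact: ((continuous_closedP _).1 ct _ (@closed_le _ 0)).
  by split.
- move=> w; split => //; apply/eqP; rewrite eqEdim subvf dimT dimL.
  by have := nL false w; have := nL true w; lia.
- by split=> t w z /LP zL; apply/LP; exact: half_orbit_bounded_propagate.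
split=> t w z t0 zL.
  by have := decay false w z t zL t0; rewrite expr0 mul1r.
have := decay true w z (- t) zL; rewrite expr1 mulN1r opprK mulrNN; apply.
by rewrite oppr_ge0.
Qed.

(** Against the direction in which [L] decays, [q] stays bounded, and so does [p] as the difference
    of two bounded terms. Flowing back, the decay on [L] makes [p] arbitrarily small. *)
Lemma dichotomy_component b w (L L' : Omega -> {vspace 'cV[C]_m}) (eta beta M : R)
    (p q : 'cV[C]_m) : 0 <= eta -> 0 < beta -> invariant_subbundle sigma U L ->
  (forall t w z, 0 <= t -> z \in L w ->
    vnorm (U ((-1) ^+ b * t) w *m z) <= eta * expR (- beta * t) * vnorm z) ->
  (forall t w z, 0 <= t -> z \in L' w ->
    vnorm (U (- ((-1) ^+ b * t)) w *m z) <= eta * expR (- beta * t) * vnorm z) ->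
  p \in L w -> q \in L' w -> (forall t, nsq (U t w *m (p + q)) <= M) -> p = 0.
Proof.
move=> eta0 beta0 invL decL decL' pL qL' pqM.
pose N := 2 * M + 2 * (eta ^+ 2 * nsq q).
apply: nsq0_eq0; apply/eqP; rewrite eq_le nsq_ge0 andbT.
apply: (@exp_decay_le0 _ _ (eta ^+ 2 * N) (2 * beta)) => [|t t0]; first exact: mulr_gt0.
pose s := - ((-1) ^+ b * t).
have eE : (eta * expR (- beta * t)) ^+ 2 = eta ^+ 2 * expR (- (2 * beta) * t).
  by rewrite exprMn expR_sqr; congr (_ * expR _); ring.
have e0 : 0 <= eta * expR (- beta * t) by rewrite mulr_ge0 ?expR_ge0.
have h1 : nsq p <= eta ^+ 2 * expR (- (2 * beta) * t) * nsq (U s w *m p).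
  have := decL t (sigma s w) (U s w *m p) t0 (invL s w p pL).
  rewrite vnorm_le// eE.
  by have := propagatorK w p s; rewrite /s opprK => ->.
apply: le_trans h1 _; rewrite mulrAC ler_wpM2r ?expR_ge0// ler_wpM2l ?sqr_ge0//.
have h2 : nsq (U s w *m q) <= eta ^+ 2 * nsq q.
  have := decL' t w q t0 qL'; rewrite vnorm_le// eE => /le_trans; apply.
  rewrite ler_wpM2r ?nsq_ge0// ler_piMr ?sqr_ge0// -expR0 ler_expR mulNr oppr_le0.
  by rewrite !mulr_ge0// ltW.
have -> : U s w *m p = U s w *m (p + q) + (-1 : C) *: (U s w *m q).
  by rewrite mulmxDr scaleN1r addrK.
apply: le_trans (nsq_add _ _) _.
rewrite nsq_scale /N; apply: lerD; rewrite ler_wpM2l//.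
have -> : re (-1 : C) ^+ 2 + im (-1 : C) ^+ 2 = 1.
  by rewrite /re /im /= oppr0 sqrrN expr1n expr0n addr0.
by rewrite mul1r.
Qed.

End Propagator.

(** Both components of [z 0] vanish by [dichotomy_component], used once in each direction of time.
    Other times are reached by shifting the solution. *)
Lemma dichotomy_no_bounded_solution w (z : R -> 'cV[C]_m) :
  exponential_dichotomy sigma A -> is_solution sigma A w z -> bounded_on_R z ->
  z 0 = 0.
Proof.
move=> [U fU [eta [beta [Lp [Lm [[eta1 beta0] _ Lpm [invp invm] [dp dm]]]]]]] sz [M zM].
have eta0 : 0 <= eta by exact: le_trans ler01 eta1.
have zU t : nsq (U t w *m z 0) <= M ^+ 2.
  rewrite -(solution_propagator fU t sz).
  have := zM t; rewrite vnormE => h.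
  rewrite -(sqr_sqrtr (nsq_ge0 (z t))) ler_pXn2r ?nnegrE ?sqrtr_ge0//.
  by rewrite (le_trans _ h) ?sqrtr_ge0.
have [Lfull _] := Lpm w.
have : z 0 \in (Lp w + Lm w)%VS by rewrite Lfull memvf.
move=> /memv_addP[p pL [q qL zpq]].
have dp' (t : R) u y : 0 <= t -> y \in Lp u ->
    vnorm (U t u *m y) <= eta * expR (- beta * t) * vnorm y by exact: dp.
have dm' (t : R) u y : 0 <= t -> y \in Lm u ->
    vnorm (U (- t) u *m y) <= eta * expR (- beta * t) * vnorm y.
  by rewrite -oppr_le0 mulNr -mulrN; exact: dm.
have zUpq t : nsq (U t w *m (p + q)) <= M ^+ 2 by rewrite -zpq.
have zUqp t : nsq (U t w *m (q + p)) <= M ^+ 2 by rewrite addrC -zpq.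
have p0 : p = 0.
  apply: (dichotomy_component fU (b := false) eta0 beta0 invp _ _ pL qL zUpq).
    by move=> t u y; rewrite expr0 mul1r; exact: dp'.
  by move=> t u y; rewrite expr0 mul1r; exact: dm'.
have q0 : q = 0.
  apply: (dichotomy_component fU (b := true) eta0 beta0 invm _ _ qL pL zUqp).
    by move=> t u y; rewrite expr1 mulN1r; exact: dm'.
  by move=> t u y; rewrite expr1 mulN1r opprK; exact: dp'.
by rewrite zpq p0 q0 addr0.
Qed.

End LinearFamily.

(** * Hamiltonian families *)

Section Hamiltonian.
Variables (R : realType) (n : nat).
Local Notation C := (Cplx R).

Definition dot (u v : 'cV[R]_n) : R := \sum_i u i 0 * v i 0.

Lemma dotC u v : dot u v = dot v u.
Proof. by apply: eq_bigr => i _; rewrite mulrC. Qed.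

Lemma dotDr u v v' : dot u (v + v') = dot u v + dot u v'.
Proof. by rewrite /dot -big_split/=; apply: eq_bigr => i _; rewrite mxE mulrDr. Qed.

Lemma dotZr (k : R) u v : dot u (k *: v) = k * dot u v.
Proof. by rewrite /dot mulr_sumr; apply: eq_bigr => i _; rewrite mxE mulrCA. Qed.

Lemma dotNr u v : dot u (- v) = - dot u v.
Proof. by rewrite -scaleN1r dotZr mulN1r. Qed.

Lemma dotZl (k : R) u v : dot (k *: u) v = k * dot u v.
Proof. by rewrite dotC dotZr dotC. Qed.

Lemma dotNl u v : dot (- u) v = - dot u v.
Proof. by rewrite dotC dotNr dotC. Qed.

Lemma dotE u v : dot u v = (u^T *m v) 0 0.
Proof. by rewrite mxE; apply: eq_bigr => i _; rewrite mxE. Qed.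

Lemma dot_mulmx (M : 'M[R]_n) u v : dot (M *m u) v = dot u (M^T *m v).
Proof. by rewrite !dotE trmx_mul mulmxA. Qed.

(** Splitting a complex vector into four real ones turns Hermitian expressions into real dot
    products. *)
Definition re1 (z : 'cV[C]_(n + n)) : 'cV[R]_n := map_mx (@re R) (usubmx z).
Definition im1 (z : 'cV[C]_(n + n)) : 'cV[R]_n := map_mx (@im R) (usubmx z).
Definition re2 (z : 'cV[C]_(n + n)) : 'cV[R]_n := map_mx (@re R) (dsubmx z).
Definition im2 (z : 'cV[C]_(n + n)) : 'cV[R]_n := map_mx (@im R) (dsubmx z).

Lemma map_re_mulmx (M : 'M[R]_n) (u : 'cV[C]_n) :
  map_mx (@re R) (map_mx (@toC R) M *m u) = M *m map_mx (@re R) u.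
Proof.
apply/colP => i; rewrite !mxE re_sum; apply: eq_bigr => j _.
by rewrite !mxE re_mul /= mul0r subr0.
Qed.

Lemma map_im_mulmx (M : 'M[R]_n) (u : 'cV[C]_n) :
  map_mx (@im R) (map_mx (@toC R) M *m u) = M *m map_mx (@im R) u.
Proof.
apply/colP => i; rewrite !mxE im_sum; apply: eq_bigr => j _.
by rewrite !mxE im_mul /= mul0r addr0.
Qed.

Lemma map_re_add (u v : 'cV[C]_n) :
  map_mx (@re R) (u + v) = map_mx (@re R) u + map_mx (@re R) v.
Proof. by apply/colP => i; rewrite !mxE re_add. Qed.

Lemma map_im_add (u v : 'cV[C]_n) :
  map_mx (@im R) (u + v) = map_mx (@im R) u + map_mx (@im R) v.
Proof. by apply/colP => i; rewrite !mxE im_add. Qed.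

Lemma map_re_opp (u : 'cV[C]_n) : map_mx (@re R) (- u) = - map_mx (@re R) u.
Proof. by apply/colP => i; rewrite !mxE; case: (u i 0). Qed.

Lemma map_im_opp (u : 'cV[C]_n) : map_mx (@im R) (- u) = - map_mx (@im R) u.
Proof. by apply/colP => i; rewrite !mxE; case: (u i 0). Qed.

Lemma map_re_scale (k : C) (u : 'cV[C]_n) :
  map_mx (@re R) (k *: u) = re k *: map_mx (@re R) u - im k *: map_mx (@im R) u.
Proof. by apply/colP => i; rewrite !mxE re_mul. Qed.

Lemma map_im_scale (k : C) (u : 'cV[C]_n) :
  map_mx (@im R) (k *: u) = re k *: map_mx (@im R) u + im k *: map_mx (@re R) u.
Proof. by apply/colP => i; rewrite !mxE im_mul. Qed.

(** With [z = (z1, z2)] this is the imaginary part of [z1^* z2], which is half of [i z^* J z]. *)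
Definition krein (z : 'cV[C]_(n + n)) : R := dot (re1 z) (im2 z) - dot (im1 z) (re2 z).

Lemma nsqE (z : 'cV[C]_(n + n)) :
  nsq z = dot (re1 z) (re1 z) + dot (im1 z) (im1 z) +
          (dot (re2 z) (re2 z) + dot (im2 z) (im2 z)).
Proof.
rewrite /nsq /sqnorm sum_coords !big_split_ord /= addrACA; congr (_ + _).
  by congr (_ + _); apply: eq_bigr => i _; rewrite !mxE expr2.
by congr (_ + _); apply: eq_bigr => i _; rewrite !mxE expr2.
Qed.

Lemma dot_ge0 u : 0 <= dot u u.
Proof. by apply: sumr_ge0 => i _; rewrite -expr2 sqr_ge0. Qed.

Lemma krein_bounded z : `|krein z| <= nsq z.
Proof.
have le u v : `|dot u v| <= dot u u / 2 + dot v v / 2.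
  rewrite /dot !mulr_suml -big_split/=.
  apply: le_trans (ler_norm_sum _ _ _) (ler_sum _ _) => i _.
  rewrite ler_norml; apply/andP; split.
    have := sqr_ge0 (u i 0 + v i 0); nra.
  have := sqr_ge0 (u i 0 - v i 0); nra.
rewrite nsqE /krein; apply: le_trans (ler_normB _ _) _.
have := le (re1 z) (im2 z); have := le (im1 z) (re2 z).
have := dot_ge0 (re1 z); have := dot_ge0 (re2 z).
have := dot_ge0 (im1 z); have := dot_ge0 (im2 z); lra.
Qed.

Variables (H1 H2 H3 D : 'M[R]_n).

(** The diagonal blocks of the defining equation are [H2^T - H2] and [H3 - H3^T]. *)
Lemma sp_symmetric : sp (block_mx H1 H3 H2 (- H1^T)) -> H2^T = H2 /\ H3^T = H3.
Proof.
rewrite /sp /Jmx tr_block_mx !mulmx_block !mulmx0 !mul0mx !mulmx1 !mul1mx !mulmxN !mulNmx.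
rewrite !mulmx1 !mul1mx !addr0 !add0r add_block_mx -block_mx0.
move=> /eq_block_mx[h1 _ _ h4]; split; first by apply/eqP; rewrite -subr_eq0 h1.
by apply/eqP; rewrite eq_sym -subr_eq0 addrC h4.
Qed.

(** The left side is the derivative of [krein] along the system. The [H1] terms cancel, symmetry
    makes the [H2] and [H3] terms real before imaginary parts are taken, and only the imaginary part
    of [l] times [z1^* D z1] remains. *)
Lemma krein_identity (l : C) (z : 'cV[C]_(n + n)) :
  H2^T = H2 -> H3^T = H3 -> D^T = D ->
  let z' := block_mx (map_mx (@toC R) H1) (map_mx (@toC R) H3)
    (map_mx (@toC R) H2 + l *: map_mx (@toC R) D) (- (map_mx (@toC R) H1)^T) *m z in
  dot (re1 z') (im2 z) + dot (re1 z) (im2 z')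
    - (dot (im1 z') (re2 z) + dot (im1 z) (re2 z')) =
  im l * (dot (re1 z) (D *m re1 z) + dot (im1 z) (D *m im1 z)).
Proof.
move=> s2 s3 sD /=.
rewrite -[in X in block_mx _ _ _ _ *m X](vsubmxK z) mul_block_col /re1 /im1 /re2 /im2.
rewrite !col_mxKu !col_mxKd.
set u := usubmx z; set v := dsubmx z.
rewrite mulmxDl -scalemxAl mulNmx map_trmx.
rewrite !map_re_add !map_im_add !map_re_opp !map_im_opp !map_re_scale !map_im_scale.
rewrite !map_re_mulmx !map_im_mulmx.
move: (map_mx _ u) (map_mx _ u) (map_mx _ v) (map_mx _ v) => a b c d.
rewrite !(dotC (_ + _)) !dotDr !dotNr !dotZr.
rewrite (dotC d (H1 *m a)) (dotC c (H1 *m b)) !dot_mulmx.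
rewrite (dotC d (H3 *m c)) dot_mulmx s3 (dotC b (H2 *m a)) dot_mulmx s2.
rewrite (dotC b (D *m a)) dot_mulmx sD; ring.
Qed.

Lemma posdef_ge0 u : posdef_mx D -> 0 <= dot u (D *m u).
Proof.
move=> pD; rewrite dotE mulmxA; have [->|u0] := eqVneq u 0; last exact/ltW/pD.
by rewrite mulmx0 mxE.
Qed.

Lemma posdef_eq0 u v : posdef_mx D -> dot u (D *m u) + dot v (D *m v) = 0 ->
  u = 0 /\ v = 0.
Proof.
move=> pD uv0.
have eq0 x : dot x (D *m x) = 0 -> x = 0.
  by move=> x0; apply/eqP/negP => /negP /pD; rewrite -mulmxA -dotE x0 ltxx.
have := posdef_ge0 u pD; have := posdef_ge0 v pD => hv hu.
by split; apply: eq0; lra.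
Qed.

End Hamiltonian.

(** * Vertical vectors and subspaces of definite Krein form *)

Lemma vertical_usubmx0 (R : realType) n (z : 'cV[Cplx R]_(n + n)) :
  re1 z = 0 -> im1 z = 0 -> z = col_mx 0 (dsubmx z).
Proof.
move=> r0 i0; rewrite -{1}[z]vsubmxK; congr col_mx.
apply/colP => i; move: r0 i0 => /colP/(_ i) + /colP/(_ i); rewrite !mxE => r0 i0.
exact: cplx_eq.
Qed.

Lemma is_derive_dot (R : realType) n (u v : R -> 'cV[R]_n) (u' v' : 'cV[R]_n) (t : R) :
  (forall i, is_derive t 1 (fun s => u s i 0) (u' i 0)) ->
  (forall i, is_derive t 1 (fun s => v s i 0) (v' i 0)) ->
  is_derive t 1 (fun s => dot (u s) (v s)) (dot u' (v t) + dot (u t) v').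
Proof.
move=> du dv; rewrite /dot -big_split/=.
apply: is_derive_bigsum => i; exact: is_derive_mul.
Qed.

(* [z2 = i k z1]: a complex subspace on which the Krein form has the sign of [k]. *)
Definition krein_subspace (R : realType) n (k : R) : {vspace 'cV[Cplx R]_(n + n)} :=
  limg (linfun (mulmx (col_mx 1%:M (cplx 0 k)%:M : 'M[Cplx R]_(n + n, n)))).

Lemma krein_subspace_dim (R : realType) n (k : R) : \dim (krein_subspace n k) = n.
Proof.
rewrite /krein_subspace limg_dim_eq; first by rewrite dimvf /dim /= muln1.
apply/eqP; rewrite -subv0; apply/subvP => y; rewrite memv_cap memv_ker lfunE /=.
move=> /andP[_ /eqP]; rewrite mul_col_mx mul1mx -col_mx0 => /eq_col_mx[-> _].
exact: mem0v.
Qed.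

(** Here [krein z] is [k] times the squared norm of [z1], and [nsq z] is [1 + k ^+ 2] times it. *)
Lemma krein_subspaceE (R : realType) n (k : R) z : z \in krein_subspace n k ->
  (1 + k ^+ 2) * krein z = k * nsq z.
Proof.
move=> /memv_imgP[y _ ->]; rewrite lfunE /= mul_col_mx mul1mx mul_scalar_mx.
rewrite nsqE /krein /re1 /im1 /re2 /im2 col_mxKu col_mxKd.
rewrite map_re_scale map_im_scale /= !scale0r !add0r.
move: (map_mx _ y) (map_mx _ y) => a b.
rewrite !dotNr !dotNl !dotZr !dotZl; ring.
Qed.

Lemma continuous_entry (R : realType) (T : topologicalType) m n
    (M : T -> 'M[R]_(m, n)) i j :
  continuous M -> continuous (fun x => M x i j).
Proof.
move=> cM x; apply: (@continuous_comp _ _ _ M (fun N : 'M[R]_(m, n) => N i j)).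
  exact: cM.
exact: coord_continuous.
Qed.

(** * Dichotomy and vertical solutions of the Hamiltonian family *)

Section HamiltonianFamily.
Variables (R : realType) (Omega : topologicalType) (sigma : R -> Omega -> Omega).
Local Notation C := (Cplx R).
Variables (n : nat) (H1 H2 H3 Delta : Omega -> 'M[R]_n).
Let F := family_coef H1 H2 H3 Delta.
Hypothesis compact_Omega : compact [set: Omega].
Hypothesis flow_sigma : continuous_flow sigma.
Hypothesis continuous_H :
  continuous (fun w => block_mx (H1 w) (H3 w) (H2 w) (- (H1 w)^T)).
Hypothesis sp_H : forall w, sp (block_mx (H1 w) (H3 w) (H2 w) (- (H1 w)^T)).
Hypothesis continuous_Delta : continuous Delta.
Hypothesis symmetric_Delta : forall w, symmetric_mx (Delta w).
Hypothesis posdef_Delta : forall w, posdef_mx (Delta w).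

Lemma family_coef_continuous l k k' : continuous (fun w => real_coef (F l w) k k').
Proof.
have cH i j : continuous (fun w => block_mx (H1 w) (H3 w) (H2 w) (- (H1 w)^T) i j).
  exact: (continuous_entry continuous_H).
have c1 i j : continuous (fun w => H1 w i j).
  by have := cH (lshift n i) (lshift n j); under eq_fun do rewrite block_mxEul.
have c2 i j : continuous (fun w => H2 w i j).
  by have := cH (rshift n i) (lshift n j); under eq_fun do rewrite block_mxEdl.
have c3 i j : continuous (fun w => H3 w i j).
  by have := cH (lshift n i) (rshift n j); under eq_fun do rewrite block_mxEur.
have cD i j : continuous (fun w => Delta w i j).
  exact: (continuous_entry continuous_Delta).
have cc (r : R) : continuous (fun _ : Omega => r) by exact: cst_continuous.
have cF (i j : 'I_(n + n)) : continuous (fun w => re (F l w i j)) /\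
    continuous (fun w => im (F l w i j)).
  rewrite /F /family_coef.
  case: (split_ordP i) => i' ->; case: (split_ordP j) => j' ->.
  - split; under eq_fun do rewrite block_mxEul mxE //=; [exact: c1|exact: cc].
  - split; under eq_fun do rewrite block_mxEur mxE //=; [exact: c3|exact: cc].
  - split.
      rewrite (_ : (fun w => _) = (fun w => H2 w i' j' + re l * Delta w i' j')).
        exact: (continuous_add (c2 i' j') (continuous_mul (cc _) (cD i' j'))).
      by apply/funext => w; rewrite block_mxEdl !mxE re_add re_mul /= mulr0 subr0.
    rewrite (_ : (fun w => _) = (fun w => im l * Delta w i' j')).
      exact: (continuous_mul (cc _) (cD i' j')).
    by apply/funext => w; rewrite block_mxEdl !mxE im_add im_mul /= mulr0 !add0r.
  - split.
      rewrite (_ : (fun w => _) = (fun w => - H1 w j' i')).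
        by move=> w; apply: cvgN; exact: c1.
      by apply/funext => w; rewrite block_mxEdr !mxE.
    rewrite (_ : (fun w => _) = (fun=> 0)); first exact: cc.
    by apply/funext => w; rewrite block_mxEdr !mxE /im /= oppr0.
case: k k' => i [] j /=; try (by case: (cF i j)).
by move=> w; apply: cvgN; case: (cF i j) => _; exact.
Qed.

Lemma krein_derive l w z (t : R) : is_solution sigma (F l) w z ->
  is_derive t 1 (fun s => krein (z s))
    (im l * (dot (re1 (z t)) (Delta (sigma t w) *m re1 (z t)) +
             dot (im1 (z t)) (Delta (sigma t w) *m im1 (z t)))).
Proof.
move=> sz; have [s2 s3] := sp_symmetric (sp_H (sigma t w)).
rewrite -(@krein_identity _ _ (H1 (sigma t w)) _ _ _ l (z t)
  s2 s3 (symmetric_Delta (sigma t w))).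
apply: is_derive_sub; apply: is_derive_dot => i.
- under eq_fun do rewrite !mxE.
  by rewrite !mxE; case: (sz t (lshift n i) 0); rewrite !mxE.
- under eq_fun do rewrite !mxE.
  by rewrite !mxE; case: (sz t (rshift n i) 0); rewrite !mxE.
- under eq_fun do rewrite !mxE.
  by rewrite !mxE; case: (sz t (lshift n i) 0); rewrite !mxE.
under eq_fun do rewrite !mxE.
by rewrite !mxE; case: (sz t (rshift n i) 0); rewrite !mxE.
Qed.

(** The parameter multiplies only the first half of the vector, which is 0. *)
Lemma vertical_all_parameters l l' w (z : R -> 'cV[C]_(n + n)) :
  vertical_bounded_solution sigma (F l) w z -> is_solution sigma (F l') w z.
Proof.
move=> [sz _ _ [z2 zE]] t; have := sz t; rewrite zE /F /family_coef !mul_block_col.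
by rewrite !mulmx0 !add0r.
Qed.

Lemma nonreal_dichotomy l : im l != 0 ->
  (forall w z, ~ vertical_bounded_solution sigma (F l) w z) ->
  exponential_dichotomy sigma (F l).
Proof.
move=> l0 novert.
have cA := @family_coef_continuous l.
have [U fU] := fundamental_matrix_exists compact_Omega flow_sigma cA.
(* The factor [im l] makes the derivative of [Q] a square times a nonnegative form, whatever the
   sign of [im l]. *)
pose Q (z : 'cV[C]_(n + n)) := im l * krein z.
have dQ w z t : is_derive t (1 : R) (fun s => Q (U s w *m z))
    (im l * (im l * (dot (re1 (U t w *m z)) (Delta (sigma t w) *m re1 (U t w *m z)) +
                     dot (im1 (U t w *m z)) (Delta (sigma t w) *m im1 (U t w *m z))))).
  apply: is_derive_cmul; apply: krein_derive; exact: propagator_solution.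
have Qc t : continuous (fun p : Omega * 'cV[C]_(n + n) => Q (U t p.1 *m p.2)).
  have cc := @propagator_coords_continuous _ _ _ _ _ compact_Omega flow_sigma cA U fU t.
  apply: continuous_mul; first exact: cst_continuous.
  rewrite (_ : (fun p => _) = (fun p : Omega * 'cV[C]_(n + n) =>
    \sum_i coords (U t p.1 *m p.2) (inl (lshift n i)) *
           coords (U t p.1 *m p.2) (inr (rshift n i)) -
    \sum_i coords (U t p.1 *m p.2) (inr (lshift n i)) *
           coords (U t p.1 *m p.2) (inl (rshift n i)))).
    apply: continuous_sub; apply: continuous_bigsum => i;
      exact: continuous_mul (cc _) (cc _).
  apply/funext => p; rewrite /krein /dot; congr (_ - _); apply: eq_bigr => i _.
    by rewrite [re1 _ _ _]mxE [im2 _ _ _]mxE [usubmx _ _ _]mxE [dsubmx _ _ _]mxE.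
  by rewrite [im1 _ _ _]mxE [re2 _ _ _]mxE [usubmx _ _ _]mxE [dsubmx _ _ _]mxE.
have Qnd w z : nondecreasing_fun (fun t => Q (U t w *m z)).
  move=> s t st; apply: (is_derive_ge0_le st (dQ w z)) => r _.
  rewrite mulrA -expr2 mulr_ge0 ?sqr_ge0// addr_ge0//; exact: posdef_ge0.
have Qb : exists2 B, 0 <= B & forall z : 'cV[C]_(n + n), `|Q z| <= B * nsq z.
  by exists `|im l| => // z; rewrite normrM ler_wpM2l// krein_bounded.
have vert w (z : 'cV[C]_(n + n)) M q : (forall t, nsq (U t w *m z) <= M) ->
    (forall t, Q (U t w *m z) = q) -> z = 0.
  move=> zM Qq; apply/eqP/negP => /negP z0.
  apply: (novert w (fun t => U t w *m z)); split.
  - exact: propagator_solution.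
  - by exists 0; rewrite (propagator0 fU) mul1mx.
  - by exists (Num.sqrt M) => t; rewrite vnormE ler_wsqrtr.
  exists (fun t => dsubmx (U t w *m z)) => t.
  (* Constancy of [Q] makes its derivative vanish, and positive definiteness of [Delta] then
     annihilates the first half of the solution. *)
  have : is_derive t (1 : R) (fun s => Q (U s w *m z)) 0.
    by under eq_fun do rewrite Qq; exact: is_derive_const.
  move=> [_ d0]; have [_] := dQ w z t; rewrite d0 => /esym/eqP.
  rewrite !mulf_eq0 (negbTE l0) /= => /eqP /(posdef_eq0 (posdef_Delta _))[r0 i0].
  exact: vertical_usubmx0.
have nb := lyapunov_no_bounded_orbit compact_Omega flow_sigma cA fU Qc Qnd Qb vert.
have [L hL] := half_orbit_bounded_vspace U.
apply: (dichotomy_of_half_orbits compact_Omega flow_sigma cA fU (erefl _) nb hL).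
(* This slope gives [(-1) ^+ b * im l * k b = -1], so [(-1) ^+ b * Q] equals
   [- nsq z / (1 + k b ^+ 2)] on the subspace; hence the value of [e] below. *)
pose k b : R := - ((-1) ^+ b / im l).
apply: (lyapunov_half_orbit_dim compact_Omega flow_sigma cA fU Qnd Qb
  (N := fun b => krein_subspace n (k b)) (e := (1 + (im l)^-1 ^+ 2)^-1) nb).
- by move=> b w z /hL.
- by move=> b; rewrite krein_subspace_dim.
- by rewrite invr_gt0 ltr_wpDr ?sqr_ge0.
move=> b z /krein_subspaceE.
have -> : k b ^+ 2 = (im l)^-1 ^+ 2 by rewrite /k sqrrN exprMn sqrr_sign mul1r.
have p0 : 0 < 1 + (im l)^-1 ^+ 2 by rewrite ltr_wpDr ?sqr_ge0.
have kk : (-1) ^+ b * (im l * k b) = -1.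
  by rewrite /k; case: (b); rewrite ?expr0 ?expr1; field.
move: kk; set s := (-1) ^+ b => kk E.
suff -> : s * Q z = - ((1 + (im l)^-1 ^+ 2)^-1 * nsq z) by [].
apply: (mulfI (lt0r_neq0 p0)); rewrite [RHS]mulrN [in RHS]mulrA divff ?lt0r_neq0// mul1r.
have -> : (1 + (im l)^-1 ^+ 2) * (s * Q z) =
    s * (im l * ((1 + (im l)^-1 ^+ 2) * krein z)) by rewrite /Q; ring.
rewrite E; have -> : s * (im l * (k b * nsq z)) = s * (im l * k b) * nsq z by ring.
by rewrite kk mulN1r.
Qed.

(** The vertical solution also solves the system for [l']; shifting a time at which it is nonzero to
    the origin contradicts [dichotomy_no_bounded_solution]. *)
Lemma vertical_no_dichotomy l l' w z : vertical_bounded_solution sigma (F l) w z ->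
  ~ exponential_dichotomy sigma (F l').
Proof.
move=> vz ed; have sz := vertical_all_parameters l' vz.
have [_ [t zt] [M zM] _] := vz.
have := dichotomy_no_bounded_solution compact_Omega flow_sigma
  (@family_coef_continuous l') ed (solution_shift flow_sigma t sz).
rewrite add0r => zt0; move/eqP: zt; apply; apply: zt0.
by exists M => s; exact: zM.
Qed.

End HamiltonianFamily.

Theorem corollary3p8 (R : realType) (Omega : metricType R)
    (compact_Omega : compact [set: Omega])
    (sigma : R -> Omega -> Omega) (flow_sigma : continuous_flow sigma)
    (n : nat) (H1 H2 H3 Delta : Omega -> 'M[R]_n)
    (H := fun w : Omega => block_mx (H1 w) (H3 w) (H2 w) (- (H1 w)^T))
    (continuous_H : continuous H) (sp_H : forall w : Omega, sp (H w))
    (continuous_Delta : continuous Delta)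
    (symmetric_Delta : forall w : Omega, symmetric_mx (Delta w))
    (posdef_Delta : forall w : Omega, posdef_mx (Delta w))
    (F := family_coef H1 H2 H3 Delta)
    (ED := fun lambda : Cplx R => exponential_dichotomy sigma (F lambda)) :
  [/\ ((exists lambda0 : Cplx R, ED lambda0) /\
       (forall lambda : Cplx R, im lambda != 0 -> ED lambda)) \/
      (forall lambda : Cplx R, ~ ED lambda),
      (forall lambda : Cplx R, ~ ED lambda) <->
      (exists (w : Omega) (lambda0 : Cplx R) (z : R -> 'cV[Cplx R]_(n + n)),
         vertical_bounded_solution sigma (F lambda0) w z) &
      forall (w : Omega) (lambda0 : Cplx R) (z : R -> 'cV[Cplx R]_(n + n)),
        vertical_bounded_solution sigma (F lambda0) w z ->
        forall lambda : Cplx R, is_solution sigma (F lambda) w z].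
Proof.
have novert_ED l : (forall w l0 z, ~ vertical_bounded_solution sigma (F l0) w z) ->
    im l != 0 -> ED l.
  by move=> nv l0; apply: nonreal_dichotomy => // w z; exact: nv.
have ED_novert l : ED l -> forall w l0 z, ~ vertical_bounded_solution sigma (F l0) w z.
  by move=> edl w l0 z vz;
    exact: (vertical_no_dichotomy compact_Omega flow_sigma
      continuous_H continuous_Delta vz edl).
split.
- have [[l edl]|nED] := pselect (exists l, ED l); last first.
    by right=> l edl; apply: nED; exists l.
  left; split; first by exists l.
  by move=> l' l'0; exact: novert_ED (ED_novert l edl) l'0.
- split=> [nED|[w [l [z vz]]] l' edl]; last exact: (ED_novert l' edl w l z vz).
  (* Without a vertical bounded solution every nonreal parameter has dichotomy; the imaginary unit
     serves as witness. *)
  apply: contrapT => nvert; apply: (nED (cplx 0 1)); apply: novert_ED => [w l0 z vz|].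
    by apply: nvert; exists w, l0, z.
  exact: oner_neq0.
by move=> w l z vz l'; exact: vertical_all_parameters vz.
Qed.
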